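(* Let $m\ge1$ be an integer and let $\tilde B,\tilde H\in\Omega_{2n}$ with $\tilde H$ invertible and Hermitian and $\tilde B$ $\tilde H$-selfadjoint. Then there exists an $\tilde H$-selfadjoint $\tilde A\in\Omega_{2n}$ with $\tilde A^m=\tilde B$ if and only if the canonical form of $(\tilde B,\tilde H)$ (up to permutation of blocks) has the following two properties: 1. If $m$ is even, the part $(\tilde B_-,\tilde H_-)$ of the canonical form corresponding to the negative eigenvalues has the form $$\tilde B_-=\bigoplus_{j=1}^t\big(J_{k_j}(\lambda_j)\oplus J_{k_j}(\lambda_j)\big)\oplus\bigoplus_{j=1}^t\big(J_{k_j}(\lambda_j)\oplus J_{k_j}(\lambda_j)\big),\quad \tilde H_-=\bigoplus_{j=1}^t\big(Q_{k_j}\oplus -Q_{k_j}\big)\oplus\bigoplus_{j=1}^t\big(Q_{k_j}\oplus -Q_{k_j}\big)$$ for some $t\ge0$, $k_j\ge1$ and $\lambda_j<0$. (If $m$ is odd, no condition is imposed on the negative eigenvalues.) 2. The part $(\tilde B_0,\tilde H_0)$ of the canonical form corresponding to the eigenvalue $0$ has the form $\tilde B_0=J_B\oplus J_B$, $\tilde H_0=H_B\oplus H_B$ with $$J_B=\bigoplus_{j=1}^t\Big(\bigoplus_{i=1}^{r_j}J_{a_j+1}(0)\oplus\bigoplus_{i=r_j+1}^{m}J_{a_j}(0)\Big),\quad H_B=\bigoplus_{j=1}^t\Big(\bigoplus_{i=1}^{r_j}\varepsilon^{(j)}_iQ_{a_j+1}\oplus\bigoplus_{i=r_j+1}^{m}\varepsilon^{(j)}_iQ_{a_j}\Big),$$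 for some $t\ge0$, integers $a_j\ge0$, $0<r_j\le m$, and signs $\varepsilon_i^{(j)}\in\{1,-1\}$ satisfying: for each $j$ there is $\eta_j\in\{1,-1\}$ such that, among $\varepsilon^{(j)}_1,\dots,\varepsilon^{(j)}_{r_j}$, if $r_j$ is even then half equal $\eta_j$ and half equal $-\eta_j$, and if $r_j$ is odd then exactly one more equals $\eta_j$ than equals $-\eta_j$; and the same rule (with the same $\eta_j$) holds for $\varepsilon^{(j)}_{r_j+1},\dots,\varepsilon^{(j)}_m$ with $m-r_j$ in place of $r_j$. (No conditions are imposed on the parts corresponding to positive or nonreal eigenvalues.)
   Context: $\Omega_{2n}=\{\begin{bmatrix}A_1&\bar A_2\\-A_2&\bar A_1\end{bmatrix}: A_1,A_2\in\mathbb{C}^{n\times n}\}\subset\mathbb{C}^{2n\times 2n}$ (the image of $\mathbb{H}^{n\times n}$ under the standard complex representation). $J_k(\lambda)$: $k\times k$ upper triangular Jordan block; $J_0(0)$ and $Q_0$ are understood as empty (absent) blocks. $Q_k$: $k\times k$ matrix with ones on the anti-diagonal, zeros elsewhere. For invertible Hermitian $H$, $A$ is $H$-selfadjoint if $HA=A^*H$. Canonical form: for $\tilde H\in\Omega_{2n}$ invertible Hermitian and $\tilde B\in\Omega_{2n}$ $\tilde H$-selfadjoint, there is an invertible $S\in\Omega_{2n}$ with $S^{-1}\tilde BS=M\oplus M'$, $S^*\tilde HS=N\oplus N$, where $M=\bigoplus_{i=1}^{\alpha}J_{k_i}(\lambda_i)\oplus\bigoplus_{i=\alpha+1}^{\beta}(J_{k_i}(\lambda_i)\oplus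 J_{k_i}(\bar\lambda_i))$, $M'=\bigoplus_{i=1}^{\alpha}J_{k_i}(\lambda_i)\oplus\bigoplus_{i=\alpha+1}^{\beta}(J_{k_i}(\bar\lambda_i)\oplus J_{k_i}(\lambda_i))$, $N=\bigoplus_{i=1}^\alpha\eta_iQ_{k_i}\oplus\bigoplus_{i=\alpha+1}^\beta Q_{2k_i}$, with $\lambda_1,\dots,\lambda_\alpha$ real, $\lambda_{\alpha+1},\dots,\lambda_\beta$ with positive imaginary part, $\eta_i=\pm1$; it is unique up to permutation of blocks. The ''part corresponding to'' a set of eigenvalues consists of the blocks of $S^{-1}\tilde BS$ with those eigenvalues (in both copies) together with the corresponding blocks of $S^*\tilde HS$. *)

(* Defs.v *)
From HB Require Import structures.
From mathcomp Require Import all_boot all_order all_algebra.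
From mathcomp Require Import reals complex.
Set Implicit Arguments. Unset Strict Implicit. Unset Printing Implicit Defensive.
Import Order.TTheory GRing.Theory Num.Theory.
Local Open Scope ring_scope.

Section QuatDefs.
Variable R : realType.
Local Notation C := (R[i]).

Definition cconj_mx (p q : nat) (A : 'M[C]_(p, q)) : 'M[C]_(p, q) := map_mx (@conjc R) A.
Definition adj_mx (p q : nat) (A : 'M[C]_(p, q)) : 'M[C]_(q, p) := (cconj_mx A)^T.

(* Omega_{2n}: image of H^{n x n} under the standard complex representation *)
Definition in_Omega (n : nat) (A : 'M[C]_(n + n)) : Prop :=
  exists A1 A2 : 'M[C]_n, A = block_mx A1 (cconj_mx A2) (- A2) (cconj_mx A1).

Definition is_hermitian_mx (N : nat) (H : 'M[C]_N) : Prop := adj_mx H = H.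

Definition H_selfadjoint (N : nat) (H A : 'M[C]_N) : Prop := H *m A = adj_mx A *m H.

Definition jordan_entry (lam : C) (i j : nat) : C :=
  if i == j then lam else if j == i.+1 then 1 else 0.
Definition antidiag_entry (k : nat) (s : C) (i j : nat) : C :=
  if i + j == k.-1 then s else 0.

(* block diagonal matrix built from a list of (size, entry function) blocks;
   meaningful when the sizes sum to N *)
Fixpoint bd_entry (s : seq (nat * (nat -> nat -> C))) (i j : nat) : C :=
  match s with
  | [::] => 0
  | (k, f) :: s' =>
      if (i < k)%N && (j < k)%N then f i j
      else if (k <= i)%N && (k <= j)%N then bd_entry s' (i - k) (j - k)
      else 0
  end.
Definition bdiag (N : nat) (s : seq (nat * (nat -> nat -> C))) : 'M[C]_N :=
  \matrix_(i < N, j < N) bd_entry s i j.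

(* Blocks of the canonical form:
   inl (k, lam, eta) : real eigenvalue lam, J_k(lam) in both M and M', eta Q_k in N
                       (eta = true means +1, false means -1);
   inr (k, a, b)     : nonreal eigenvalue lam = a + i b with b > 0,
                       J_k(lam) (+) J_k(conj lam) in M, J_k(conj lam) (+) J_k(lam) in M',
                       Q_{2k} in N. *)
Definition cblock := ((nat * R * bool) + (nat * R * R))%type.

Definition sgn (e : bool) : C := if e then 1 else -1.

Definition cb_valid (b : cblock) : bool :=
  match b with
  | inl (k, _, _) => (0 < k)%N
  | inr (k, _, y) => (0 < k)%N && (0 < y)
  end.

Definition cb_size (b : cblock) : nat :=
  match b with inl (k, _, _) => k | inr (k, _, _) => k.*2 end.

Definition cb_M (b : cblock) : seq (nat * (nat -> nat -> C)) :=
  match b with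
  | inl (k, l, _) => [:: (k, jordan_entry (l%:C))]
  | inr (k, x, y) => [:: (k, jordan_entry (x +i* y)); (k, jordan_entry (x -i* y))]
  end%C.
Definition cb_M' (b : cblock) : seq (nat * (nat -> nat -> C)) :=
  match b with
  | inl (k, l, _) => [:: (k, jordan_entry (l%:C))]
  | inr (k, x, y) => [:: (k, jordan_entry (x -i* y)); (k, jordan_entry (x +i* y))]
  end%C.
Definition cb_N (b : cblock) : seq (nat * (nat -> nat -> C)) :=
  match b with
  | inl (k, _, e) => [:: (k, antidiag_entry k (sgn e))]
  | inr (k, _, _) => [:: (k.*2, antidiag_entry k.*2 1)]
  end.

Definition cf_M (cf : seq cblock) := flatten (map cb_M cf).
Definition cf_M' (cf : seq cblock) := flatten (map cb_M' cf).
Definition cf_N (cf : seq cblock) := flatten (map cb_N cf).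

Definition canonical_reduction (n : nat) (B H S : 'M[C]_(n + n)) (cf : seq cblock) : Prop :=
  [/\ in_Omega S, S \in unitmx, all cb_valid cf, sumn (map cb_size cf) = n &
    (invmx S *m B *m S = block_mx (bdiag n (cf_M cf)) 0 0 (bdiag n (cf_M' cf))
     /\ adj_mx S *m H *m S = block_mx (bdiag n (cf_N cf)) 0 0 (bdiag n (cf_N cf)))].

(* real blocks with negative / zero eigenvalue (these, in both copies, form the
   part of the canonical form corresponding to negative / zero eigenvalues) *)
Definition neg_part (cf : seq cblock) : seq cblock :=
  [seq b <- cf | if b is inl (_, l, _) then l < 0 else false].
Definition zero_part (cf : seq cblock) : seq cblock :=
  [seq b <- cf | if b is inl (_, l, _) then l == 0 else false].

Definition cond_neg (cf : seq cblock) : Prop :=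
  exists ts : seq (nat * R),
    all (fun t => (0 < t.1)%N && (t.2 < 0)) ts /\
    perm_eq (neg_part cf)
      (flatten [seq [:: inl (t.1, t.2, true); inl (t.1, t.2, false)] | t <- ts]).

Definition zero_group (a r : nat) (eps : seq bool) : seq cblock :=
  [seq inl (a.+1, 0, e) | e <- take r eps] ++
  (if (0 < a)%N then [seq inl (a, 0, e) | e <- drop r eps] else [::]).

Definition balanced (eta : bool) (s : seq bool) : bool :=
  if odd (size s) then count (pred1 eta) s == (count (pred1 (~~ eta)) s).+1
  else count (pred1 eta) s == count (pred1 (~~ eta)) s.

Definition cond_zero (m : nat) (cf : seq cblock) : Prop :=
  exists gs : seq (nat * nat * seq bool),
    all (fun g => let: (a, r, eps) := g in
           [&& (0 < r)%N, (r <= m)%N, size eps == m &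
               [exists eta : bool, balanced eta (take r eps) && balanced eta (drop r eps)]]) gs /\
    perm_eq (zero_part cf)
      (flatten [seq let: (a, r, eps) := g in zero_group a r eps | g <- gs]).

End QuatDefs.

(* Main.v *)
Require Import Defs.
From HB Require Import structures.
From mathcomp Require Import all_boot all_order all_algebra.
From mathcomp Require Import reals complex.
From mathcomp Require Import zify ring.
Set Implicit Arguments. Unset Strict Implicit. Unset Printing Implicit Defensive.
Import Order.TTheory GRing.Theory Num.Theory.
Local Open Scope ring_scope.

(** A matrix in Omega_{2n} commutes with the antilinear map v |-> J conj(v), so a canonical
    reduction amounts to n complex columns W, the other n being J conj(W), that span a
    B-invariant space, have the prescribed Gram matrix for H, and are H-orthogonal to
    J conj(W).  Such frames are built one Jordan chain at a time inside the H-orthogonal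
    complement of what is already found; the skew-symmetry of the bilinear form
    (x, y) |-> x^* H J conj(y) makes every chain orthogonal to its own quaternionic conjugate.
    This yields the canonical form of a root A, and the canonical form of A^m is then computed
    block by block with complex matrices only: a nonzero real block stays a block, a nonreal
    pair whose m-th power is real becomes a pair of opposite signs, and J_N(0)^m splits along
    the residue classes modulo m, which the anti-diagonal form pairs off by c + c' = N - 1.
    Conversely the two conditions say exactly that the block list of B arises in this way from
    the blocks of some A, up to permutation. *)

Local Arguments conjc : simpl never.

(** * Powers acting on vectors *)

Section MatrixPowers.
Variables (T : pzRingType) (p : nat).
Implicit Types (A B : 'M[T]_p).

Lemma mulmx_expr0 q A (x : 'M_(p, q)) : A ^+ 0 *m x = x.
Proof. by rewrite expr0 -idmxE mul1mx. Qed.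

Lemma mulmx_exprD q A i j (x : 'M_(p, q)) : A ^+ i *m (A ^+ j *m x) = A ^+ (i + j) *m x.
Proof. by rewrite mulmxA mulmxE exprD. Qed.

Lemma mulmx_exprS q A i (x : 'M_(p, q)) : A *m (A ^+ i *m x) = A ^+ i.+1 *m x.
Proof. by rewrite mulmxA mulmxE -exprS. Qed.

Lemma mulmx_exprSr q A i (x : 'M_(p, q)) : A ^+ i *m (A *m x) = A ^+ i.+1 *m x.
Proof. by rewrite mulmxA mulmxE -exprSr. Qed.

Lemma mulmx_expr_eq0 q A i j (x : 'M_(p, q)) :
  A ^+ i *m x = 0 -> (i <= j)%N -> A ^+ j *m x = 0.
Proof. by move=> Aix0 le_ij; rewrite -(subnK le_ij) -mulmx_exprD Aix0 mulmx0. Qed.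

Lemma comm_mxX A B i : comm_mx A B -> comm_mx A (B ^+ i).
Proof. exact: commrX. Qed.

Lemma intertwine_expr q A (S : 'M_(p, q)) (D : 'M_q) m :
  A *m S = S *m D -> A ^+ m *m S = S *m D ^+ m.
Proof.
move=> AS; elim: m => [|m IH]; first by rewrite mulmx_expr0 expr0 -idmxE mulmx1.
by rewrite -mulmx_exprS IH mulmxA AS -mulmxA mulmxE -exprS.
Qed.

Lemma mulmx_col q r (A : 'M[T]_(p, q)) (B : 'M_(q, r)) j : A *m col j B = col j (A *m B).
Proof. by rewrite !colE mulmxA. Qed.

Lemma col_matrixP q (A B : 'M[T]_(p, q)) : (forall j, col j A = col j B) <-> A = B.
Proof.
split=> [eqAB|-> //]; apply/matrixP => i j.
by have /colP/(_ i) := eqAB j; rewrite !mxE.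
Qed.

End MatrixPowers.

Lemma scalar_mxX (T : comPzRingType) p (a : T) m : (a%:M : 'M[T]_p) ^+ m = (a ^+ m)%:M.
Proof. by elim: m => [|m IH]; rewrite ?expr0 // !exprS IH -mulmxE -scalar_mxM. Qed.

(** * Shifted matrices and chains of vectors *)

Section ShiftedMatrix.
Variable T : comPzRingType.

Definition unit_col k (j : nat) : 'cV[T]_k := \col_(i < k) (i == j :> nat)%:R.

Lemma mul_unit_col p k (A : 'M_(p, k)) j (lt_jk : (j < k)%N) :
  A *m unit_col k j = col (Ordinal lt_jk) A.
Proof.
rewrite colE; congr (_ *m _).
by apply/matrixP => i i'; rewrite !mxE ord1 eqxx andbT -val_eqE.
Qed.

Definition shift_mx p (M : 'M[T]_p) (a : T) : 'M[T]_p := M - a%:M.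

Lemma mulmx_shift p q (M : 'M_p) a (x : 'M_(p, q)) : M *m x = shift_mx M a *m x + a *: x.
Proof. by rewrite mulmxBl mul_scalar_mx subrK. Qed.

Lemma shift_mx0 p (M : 'M_p) : shift_mx M 0 = M.
Proof. by rewrite /shift_mx raddf0 subr0. Qed.

Lemma comm_mx_shift p (A M : 'M_p) a : comm_mx A M -> comm_mx A (shift_mx M a).
Proof. by move=> AM; apply: comm_mxB => //; apply: comm_mx_scalar. Qed.

Definition chain p k (N : 'M[T]_p) (x : 'cV[T]_p) : 'M[T]_(p, k) :=
  \matrix_(i, j) (N ^+ (k.-1 - j) *m x) i 0.

Lemma col_chain p k (N : 'M_p) x (j : 'I_k) : col j (chain k N x) = N ^+ (k.-1 - j) *m x.
Proof. by apply/colP => i; rewrite !mxE. Qed.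

Lemma mul_chain p k (P N : 'M_p) x : comm_mx P N -> P *m x = x -> P *m chain k N x = chain k N x.
Proof.
move=> PN Px; apply/col_matrixP => j.
by rewrite -mulmx_col col_chain mulmxA (comm_mxX _ PN) -mulmxA Px.
Qed.

Lemma shift_expr_factor p (M : 'M[T]_p) a m :
  exists Q : 'M_p, [/\ shift_mx (M ^+ m) (a ^+ m) = Q * shift_mx M a,
    GRing.comm Q (shift_mx M a) &
    forall w : 'cV_p, shift_mx M a *m w = 0 -> Q *m w = (a ^+ m.-1 *+ m) *: w].
Proof.
have commMa : GRing.comm M a%:M by apply: comm_mx_scalar.
pose Q : 'M_p := \sum_(i < m) M ^+ (m.-1 - i) * a%:M ^+ i.
have comm_shift_a : GRing.comm (shift_mx M a) a%:M by apply: comm_mx_scalar.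
have comm_shift_M : GRing.comm (shift_mx M a) M by apply/commr_sym/comm_mx_shift.
have commQ : GRing.comm Q (shift_mx M a).
  by apply/commr_sym/commr_sum => i _; apply: commrM; apply: commrX.
exists Q; split=> //.
  by rewrite commQ /shift_mx -scalar_mxX subrXX_comm.
move=> w Nw; have Mw : M *m w = a *: w by rewrite (mulmx_shift M a) Nw add0r.
have MXw i : M ^+ i *m w = a ^+ i *: w.
  elim: i => [|i IH]; first by rewrite mulmx_expr0 scale1r.
  by rewrite -mulmx_exprS IH -scalemxAr Mw scalerA -exprSr.
rewrite mulmx_suml (eq_bigr (fun=> a ^+ m.-1 *: w)); last first.
  move=> i _; rewrite -mulmxE -mulmxA scalar_mxX mul_scalar_mx -scalemxAr MXw scalerA -exprD.
  by congr (_ ^+ _ *: _); have := ltn_ord i; lia.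
by rewrite sumr_const card_ord scalerMnl.
Qed.

Lemma shift_expr_jordan_vector p (M : 'M[T]_p) a m k (x : 'cV_p) :
  shift_mx M a ^+ k *m x = 0 ->
  shift_mx (M ^+ m) (a ^+ m) ^+ k *m x = 0 /\
  shift_mx (M ^+ m) (a ^+ m) ^+ k.-1 *m x =
    (a ^+ m.-1 *+ m) ^+ k.-1 *: (shift_mx M a ^+ k.-1 *m x).
Proof.
move=> Nkx; have [Q [-> commQ Qw]] := shift_expr_factor M a m.
have QNX j : (Q * shift_mx M a) ^+ j *m x = Q ^+ j *m (shift_mx M a ^+ j *m x).
  by rewrite exprMn_comm // mulmxA mulmxE.
rewrite !QNX Nkx mulmx0; split=> //; case: k Nkx => [|k] Nkx.
  by rewrite !mulmx_expr0 scale1r.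
set w := shift_mx M a ^+ k *m x; have Nw : shift_mx M a *m w = 0 by rewrite mulmx_exprS.
suff QXw j : Q ^+ j *m w = (a ^+ m.-1 *+ m) ^+ j *: w by exact: QXw.
elim: j => [|j IH]; first by rewrite mulmx_expr0 scale1r.
by rewrite -mulmx_exprS IH -scalemxAr Qw // scalerA -exprSr.
Qed.

End ShiftedMatrix.

(** * Direct sums of two matrices *)

Section DirectSum.
Variable T : pzRingType.

Definition dsum_mx p q r s (A : 'M[T]_(p, q)) (B : 'M[T]_(r, s)) : 'M_(p + r, q + s) :=
  block_mx A 0 0 B.

Lemma mulmx_dsum p q r p' q' r' (A : 'M_(p, q)) (A' : 'M_(p', q'))
    (B : 'M_(q, r)) (B' : 'M_(q', r')) :
  dsum_mx A A' *m dsum_mx B B' = dsum_mx (A *m B) (A' *m B').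
Proof. by rewrite mulmx_block !mulmx0 !mul0mx !addr0 !add0r. Qed.

Lemma mul_row_dsum_mx p q q' r r' (A : 'M_(p, q)) (A' : 'M_(p, q'))
    (B : 'M_(q, r)) (B' : 'M_(q', r')) :
  row_mx A A' *m dsum_mx B B' = row_mx (A *m B) (A' *m B').
Proof. by rewrite mul_row_block !mulmx0 addr0 add0r. Qed.

Lemma dsum_scalar_mx p q (a : T) : dsum_mx a%:M a%:M = a%:M :> 'M_(p + q).
Proof. by rewrite [RHS]scalar_mx_block. Qed.

Lemma expr_dsum_mx p q (A : 'M_p) (B : 'M_q) m : dsum_mx A B ^+ m = dsum_mx (A ^+ m) (B ^+ m).
Proof.
elim: m => [|m IH]; first by rewrite !expr0 -!idmxE dsum_scalar_mx.
by rewrite !exprS -!mulmxE IH mulmx_dsum.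
Qed.

End DirectSum.

(** * Conjugates, adjoints and Gram matrices *)

Section Adjoint.
Variable R : realType.
Local Notation C := (R[i]).

HB.instance Definition _ p q := GRing.Additive.copy (@cconj_mx R p q) (map_mx (@conjc R)).

Fact adj_mx_is_zmod_morphism p q : zmod_morphism (@adj_mx R p q).
Proof. by move=> A B; rewrite /adj_mx !raddfB. Qed.

HB.instance Definition _ p q :=
  GRing.isZmodMorphism.Build 'M[C]_(p, q) 'M[C]_(q, p) (@adj_mx R p q)
    (@adj_mx_is_zmod_morphism p q).

Lemma cconj_mxM p q r (A : 'M[C]_(p, q)) (B : 'M_(q, r)) :
  cconj_mx (A *m B) = cconj_mx A *m cconj_mx B.
Proof. exact: map_mxM. Qed.

Lemma cconj_scalar_mx p (a : C) : cconj_mx (a%:M : 'M_p) = (a^*%C)%:M.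
Proof. exact: map_scalar_mx. Qed.

Lemma cconj_mxK p q : involutive (@cconj_mx R p q).
Proof. by move=> A; apply/matrixP => i j; rewrite !mxE conjcK. Qed.

Lemma cconj_trmx p q (A : 'M[C]_(p, q)) : cconj_mx A^T = (cconj_mx A)^T.
Proof. by rewrite /cconj_mx map_trmx. Qed.

Lemma cconj_mxX p (A : 'M[C]_p) m : cconj_mx (A ^+ m) = cconj_mx A ^+ m.
Proof. exact: rmorphXn. Qed.

Lemma cconj_row_mx p q r (A : 'M[C]_(p, q)) (B : 'M_(p, r)) :
  cconj_mx (row_mx A B) = row_mx (cconj_mx A) (cconj_mx B).
Proof. exact: map_row_mx. Qed.

Lemma cconj_col_mx p q r (A : 'M[C]_(q, p)) (B : 'M_(r, p)) :
  cconj_mx (col_mx A B) = col_mx (cconj_mx A) (cconj_mx B).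
Proof. exact: map_col_mx. Qed.

Lemma cconj_block_mx p q r s (A : 'M[C]_(p, q)) B D (E : 'M_(r, s)) :
  cconj_mx (block_mx A B D E) =
  block_mx (cconj_mx A) (cconj_mx B) (cconj_mx D) (cconj_mx E).
Proof. exact: map_block_mx. Qed.

Lemma cconj_dsum_mx p q r s (A : 'M[C]_(p, q)) (B : 'M_(r, s)) :
  cconj_mx (dsum_mx A B) = dsum_mx (cconj_mx A) (cconj_mx B).
Proof. by rewrite cconj_block_mx !raddf0. Qed.

Lemma adj_mxM p q r (A : 'M[C]_(p, q)) (B : 'M_(q, r)) :
  adj_mx (A *m B) = adj_mx B *m adj_mx A.
Proof. by rewrite /adj_mx cconj_mxM trmx_mul. Qed.

Lemma adj_mxZ p q a (A : 'M[C]_(p, q)) : adj_mx (a *: A) = a^*%C *: adj_mx A.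
Proof. by rewrite /adj_mx /cconj_mx map_mxZ linearZ. Qed.

Lemma adj_scalar_mx p (a : C) : adj_mx (a%:M : 'M_p) = (a^*%C)%:M.
Proof. by rewrite /adj_mx cconj_scalar_mx tr_scalar_mx. Qed.

Lemma adj_mx1 p : adj_mx (1%:M : 'M[C]_p) = 1%:M.
Proof. by rewrite adj_scalar_mx conjc1. Qed.

Lemma adj_mxK p q (A : 'M[C]_(p, q)) : adj_mx (adj_mx A) = A.
Proof. by rewrite /adj_mx cconj_trmx cconj_mxK trmxK. Qed.

Lemma adj_cconj_mx p q (A : 'M[C]_(p, q)) : adj_mx (cconj_mx A) = A^T.
Proof. by rewrite /adj_mx cconj_mxK. Qed.

Lemma cconj_adj_mx p q (A : 'M[C]_(p, q)) : cconj_mx (adj_mx A) = A^T.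
Proof. by rewrite /adj_mx cconj_trmx cconj_mxK. Qed.

Lemma adj_row_mx p q r (A : 'M[C]_(p, q)) (B : 'M_(p, r)) :
  adj_mx (row_mx A B) = col_mx (adj_mx A) (adj_mx B).
Proof. by rewrite /adj_mx cconj_row_mx tr_row_mx. Qed.

Lemma adj_block_mx p q r s (A : 'M[C]_(p, q)) B D (E : 'M_(r, s)) :
  adj_mx (block_mx A B D E) = block_mx (adj_mx A) (adj_mx D) (adj_mx B) (adj_mx E).
Proof. by rewrite /adj_mx cconj_block_mx tr_block_mx. Qed.

Lemma adj_dsum_mx p q r s (A : 'M[C]_(p, q)) (B : 'M_(r, s)) :
  adj_mx (dsum_mx A B) = dsum_mx (adj_mx A) (adj_mx B).
Proof. by rewrite adj_block_mx !raddf0. Qed.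

Lemma adj_col p q (A : 'M[C]_(p, q)) j : adj_mx (col j A) = row j (adj_mx A).
Proof. by apply/matrixP => i k; rewrite !mxE. Qed.

Definition H_adjoint p (H A' A : 'M[C]_p) : Prop := H *m A = adj_mx A' *m H.

Lemma H_adjointX p (H A' A : 'M[C]_p) m : H_adjoint H A' A -> H_adjoint H (A' ^+ m) (A ^+ m).
Proof.
move=> HA; elim: m => [|m IH].
  by rewrite /H_adjoint !expr0 -idmxE adj_mx1 mulmx1 mul1mx.
by rewrite /H_adjoint exprS exprSr -!mulmxE mulmxA HA -mulmxA IH mulmxA -adj_mxM.
Qed.

Lemma H_selfadjointX p (H A : 'M[C]_p) m : H_selfadjoint H A -> H_selfadjoint H (A ^+ m).
Proof. exact: H_adjointX. Qed.

Lemma dsum_selfadjoint p q (H A : 'M[C]_p) (H' A' : 'M_q) :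
  H_selfadjoint H A -> H_selfadjoint H' A' -> H_selfadjoint (dsum_mx H H') (dsum_mx A A').
Proof. by rewrite /H_selfadjoint adj_dsum_mx !mulmx_dsum => -> ->. Qed.

Section Gram.
Variables (p : nat) (H : 'M[C]_p).

Definition gram k l (U : 'M[C]_(p, k)) (W : 'M[C]_(p, l)) : 'M_(k, l) := adj_mx U *m H *m W.

Definition ip (x y : 'cV[C]_p) : C := gram x y 0 0.

Lemma gram_mull k k' l (U : 'M_(p, k)) (S : 'M_(k, k')) (W : 'M_(p, l)) :
  gram (U *m S) W = adj_mx S *m gram U W.
Proof. by rewrite /gram adj_mxM !mulmxA. Qed.

Lemma gram_mulr k l l' (U : 'M_(p, k)) (W : 'M_(p, l)) (S : 'M_(l, l')) :
  gram U (W *m S) = gram U W *m S.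
Proof. exact: mulmxA. Qed.

Lemma gram_row_mxr k l l' (U : 'M_(p, k)) (W : 'M_(p, l)) (W' : 'M_(p, l')) :
  gram U (row_mx W W') = row_mx (gram U W) (gram U W').
Proof. exact: mul_mx_row. Qed.

Lemma gram_row_mxl k k' l (U : 'M_(p, k)) (U' : 'M_(p, k')) (W : 'M_(p, l)) :
  gram (row_mx U U') W = col_mx (gram U W) (gram U' W).
Proof. by rewrite /gram adj_row_mx !mul_col_mx. Qed.

Lemma gram_row_mx k k' l l' (U : 'M_(p, k)) (U' : 'M_(p, k')) (W : 'M_(p, l)) (W' : 'M_(p, l')) :
  gram (row_mx U U') (row_mx W W') =
  block_mx (gram U W) (gram U W') (gram U' W) (gram U' W').
Proof. by rewrite gram_row_mxl !gram_row_mxr. Qed.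

Lemma gramE k l (U : 'M_(p, k)) (W : 'M_(p, l)) i j : gram U W i j = ip (col i U) (col j W).
Proof. by rewrite /ip /gram adj_col -!row_mul mulmx_col !mxE. Qed.

Lemma gram_adjoint A' A k l (U : 'M_(p, k)) (W : 'M_(p, l)) :
  H_adjoint H A' A -> gram (A' *m U) W = gram U (A *m W).
Proof. by move=> HA; rewrite /gram adj_mxM -!mulmxA (mulmxA _ H) -HA !mulmxA. Qed.

Lemma ipDl x y z : ip (x + y) z = ip x z + ip y z.
Proof. by rewrite /ip /gram raddfD !mulmxDl mxE. Qed.

Lemma ipDr x y z : ip z (x + y) = ip z x + ip z y.
Proof. by rewrite /ip /gram !mulmxDr mxE. Qed.

Lemma ipZl a x z : ip (a *: x) z = a^*%C * ip x z.
Proof. by rewrite /ip /gram adj_mxZ -!scalemxAl mxE. Qed.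

Lemma ipZr a x z : ip z (a *: x) = a * ip z x.
Proof. by rewrite /ip /gram -!scalemxAr mxE. Qed.

Lemma ip0r z : ip z 0 = 0.
Proof. by rewrite /ip /gram mulmx0 mxE. Qed.

Lemma ip0l z : ip 0 z = 0.
Proof. by rewrite /ip /gram raddf0 !mul0mx mxE. Qed.

Lemma ip_adjoint A' A x y : H_adjoint H A' A -> ip (A' *m x) y = ip x (A *m y).
Proof. by move=> HA; rewrite /ip (gram_adjoint _ _ HA). Qed.

Hypothesis hermH : is_hermitian_mx H.

Lemma adj_gram k l (U : 'M_(p, k)) (W : 'M_(p, l)) : adj_mx (gram U W) = gram W U.
Proof. by rewrite /gram !adj_mxM adj_mxK hermH mulmxA. Qed.

Lemma gram_eq0_sym k l (U : 'M_(p, k)) (W : 'M_(p, l)) : gram U W = 0 -> gram W U = 0.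
Proof. by move=> UW0; rewrite -adj_gram UW0 raddf0. Qed.

Lemma ipC x y : (ip x y)^*%C = ip y x.
Proof. by rewrite /ip -[gram y x]adj_gram !mxE. Qed.

End Gram.
End Adjoint.

(** * Isometric embeddings of pairs *)

Section PairEmbedding.
Variable R : realType.
Local Notation C := (R[i]).

Definition pair_embedding p k (M H : 'M[C]_p) (W : 'M[C]_(p, k)) (M' H' : 'M[C]_k) : Prop :=
  M *m W = W *m M' /\ gram H W W = H'.

Lemma pair_embedding_comp p k l (M H : 'M_p) (W : 'M_(p, k)) (M' H' : 'M_k)
    (W' : 'M_(k, l)) (M'' H'' : 'M_l) :
  pair_embedding M H W M' H' -> pair_embedding M' H' W' M'' H'' ->
  pair_embedding M H (W *m W') M'' H''.
Proof.
move=> [MW HW] [MW' HW']; split; first by rewrite mulmxA MW -mulmxA MW' mulmxA.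
by rewrite gram_mull gram_mulr HW mulmxA.
Qed.

Lemma pair_embeddingX p k m (M H : 'M_p) (W : 'M_(p, k)) (M' H' : 'M_k) :
  pair_embedding M H W M' H' -> pair_embedding (M ^+ m) H W (M' ^+ m) H'.
Proof. by case=> MW HW; split=> //; apply: intertwine_expr. Qed.

Lemma pair_embedding_inv p (M H W M' H' : 'M_p) : W \in unitmx ->
  pair_embedding M H W M' H' -> pair_embedding M' H' (invmx W) M H.
Proof.
move=> uW [MW <-]; split.
  by apply: (can_inj (mulKmx uW)); rewrite !mulmxA mulmxV // mul1mx -MW mulmxK.
rewrite /gram !mulmxA -adj_mxM mulmxV // adj_mx1 mul1mx -mulmxA.
by rewrite mulmxV // mulmx1.
Qed.

Lemma pair_embedding_conj p (M H W : 'M_p) : W \in unitmx ->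
  pair_embedding M H W (invmx W *m M *m W) (gram H W W).
Proof. by move=> uW; split=> //; rewrite !mulmxA mulmxV // mul1mx. Qed.

Lemma pair_embedding_selfadjoint p k (M H : 'M_p) (W : 'M_(p, k)) (M' H' : 'M_k) :
  pair_embedding M H W M' H' -> H_selfadjoint H M -> H_selfadjoint H' M'.
Proof.
move=> [MW <-] HM; rewrite /H_selfadjoint -gram_mulr -gram_mull -MW.
exact/esym/gram_adjoint.
Qed.

Lemma pair_embedding_row_mx p k l (M H : 'M_p) (W : 'M_(p, k)) (W' : 'M_(p, l)) (M1 H1 : 'M_k)
    (M2 H2 : 'M_l) :
  is_hermitian_mx H -> pair_embedding M H W M1 H1 -> pair_embedding M H W' M2 H2 ->
  gram H W W' = 0 -> pair_embedding M H (row_mx W W') (dsum_mx M1 M2) (dsum_mx H1 H2).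
Proof.
move=> hermH [MW HW] [MW' HW'] WW'; split.
  by rewrite mul_mx_row MW MW' mul_row_dsum_mx.
by rewrite gram_row_mx HW HW' WW' (gram_eq0_sym hermH WW').
Qed.

Lemma pair_embedding_dsum p q k l (M1 H1 : 'M_p) (M2 H2 : 'M_q) (W1 : 'M_(p, k))
    (W2 : 'M_(q, l)) (M1' H1' : 'M_k) (M2' H2' : 'M_l) :
  pair_embedding M1 H1 W1 M1' H1' -> pair_embedding M2 H2 W2 M2' H2' ->
  pair_embedding (dsum_mx M1 M2) (dsum_mx H1 H2) (dsum_mx W1 W2)
    (dsum_mx M1' M2') (dsum_mx H1' H2').
Proof.
move=> [MW1 <-] [MW2 <-]; split; first by rewrite !mulmx_dsum MW1 MW2.
by rewrite /gram adj_dsum_mx !mulmx_dsum.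
Qed.

Section GramUnit.
Variables (p k : nat) (H : 'M[C]_p) (S : 'M[C]_(p, k)).
Hypothesis uG : gram H S S \in unitmx.

Definition orth_proj : 'M[C]_p := 1%:M - S *m invmx (gram H S S) *m (adj_mx S *m H).

Lemma gram_unit_leq : (k <= p)%N.
Proof.
apply: leq_trans (rank_leq_row S).
apply: (mulmx1_min_rank (M := invmx (gram H S S) *m (adj_mx S *m H)) (N := 1%:M)).
by rewrite mulmx1 -mulmxA mulVmx.
Qed.

Lemma orth_proj_neq0 : (k < p)%N -> orth_proj != 0.
Proof.
move=> lt_kp; rewrite subr_eq0; apply: contraL lt_kp => /eqP proj1; rewrite -leqNgt.
apply: leq_trans (rank_leq_col S).
apply: (mulmx1_min_rank (M := 1%:M) (N := invmx (gram H S S) *m (adj_mx S *m H))).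
by rewrite mul1mx mulmxA -proj1.
Qed.

Lemma gram_orth_proj : gram H S orth_proj = 0.
Proof.
rewrite /gram mulmxBr mulmx1 -!mulmxA (mulmxA _ H) (mulmxA _ S) -/(gram H S S).
by rewrite (mulmxA _ (invmx _)) mulmxV // mul1mx subrr.
Qed.

Lemma orth_proj_idem : orth_proj *m orth_proj = orth_proj.
Proof.
rewrite {1}/orth_proj mulmxBl mul1mx -[X in _ - X]mulmxA [_ *m H *m _]gram_orth_proj.
by rewrite mulmx0 subr0.
Qed.

Lemma orth_proj_comm A T : H_selfadjoint H A -> A *m S = S *m T -> comm_mx A orth_proj.
Proof.
move=> HA AS; apply: comm_mxB; first exact: comm_mx1.
have GT : gram H S S *m T = adj_mx T *m gram H S S.
  by apply: (pair_embedding_selfadjoint (conj AS erefl)).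
have TG : T *m invmx (gram H S S) = invmx (gram H S S) *m adj_mx T.
  by apply: (can_inj (mulKmx uG)); rewrite mulmxA GT (mulmxK uG) (mulKVmx uG).
rewrite /comm_mx !mulmxA AS -(mulmxA S T) TG; rewrite -!mulmxA; congr (_ *m (_ *m _)).
by rewrite HA (mulmxA _ (adj_mx A)) -adj_mxM AS adj_mxM -!mulmxA.
Qed.

Hypothesis hermH : is_hermitian_mx H.

Lemma orth_proj_selfadjoint : H_selfadjoint H orth_proj.
Proof.
have adjV : adj_mx (invmx (gram H S S)) = invmx (gram H S S).
  apply: (can_inj (mulmxK uG)); rewrite mulVmx // -{2}(adj_gram hermH S S) -adj_mxM.
  by rewrite mulmxV //; exact: adj_mx1.
rewrite /H_selfadjoint mulmxBr raddfB /= mulmxBl mulmx1 adj_mx1 mul1mx; congr (_ - _).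
by rewrite !adj_mxM adj_mxK adjV hermH !mulmxA.
Qed.

End GramUnit.
End PairEmbedding.

(** * Jordan blocks and canonical block lists *)

Section JordanMatrix.
Variable R : realType.
Local Notation C := (R[i]).
Implicit Types (k : nat) (a s : C).

Definition jordan_mx k a : 'M[C]_k := \matrix_(i, j) jordan_entry a i j.
Definition antidiag_mx k s : 'M[C]_k := \matrix_(i, j) antidiag_entry k s i j.

Lemma cconj_jordan_mx k a : cconj_mx (jordan_mx k a) = jordan_mx k a^*%C.
Proof.
apply/matrixP => i j; rewrite !mxE /jordan_entry.
by do 2?case: ifP => _ //; rewrite ?conjc1 ?conjc0.
Qed.

(* In [antidiag_entry] the indices are added in the semiring [nat], not by [addn]. *)
Lemma antidiag_entryE k s i j : antidiag_entry k s i j = if (i + j == k.-1)%N then s else 0.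
Proof. by []. Qed.

Lemma antidiag_mxE k s i j : antidiag_mx k s i j = s *+ (j == rev_ord i).
Proof.
rewrite mxE antidiag_entryE -val_eqE /=; have := ltn_ord i; have := ltn_ord j.
by do 2?case: eqP => ?; rewrite ?mulr1n ?mulr0n //; lia.
Qed.

Lemma antidiag_mulmx k q s (A : 'M_(k, q)) :
  antidiag_mx k s *m A = s *: \matrix_(i, j) A (rev_ord i) j.
Proof.
apply/matrixP => i j; rewrite !mxE (bigD1 (rev_ord i)) //= antidiag_mxE eqxx mulr1n.
rewrite big1 ?addr0 // => l /negPf l_neq.
by rewrite antidiag_mxE l_neq mul0r.
Qed.

Lemma tr_antidiag_mx k s : (antidiag_mx k s)^T = antidiag_mx k s.
Proof. by apply/matrixP => i j; rewrite !mxE !antidiag_entryE addnC. Qed.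

Lemma mulmx_antidiag k q s (A : 'M_(q, k)) :
  A *m antidiag_mx k s = s *: \matrix_(i, j) A i (rev_ord j).
Proof.
apply: trmx_inj; rewrite trmx_mul tr_antidiag_mx antidiag_mulmx.
by apply/matrixP => i j; rewrite !mxE.
Qed.

Lemma antidiag_mx_sqr k s : s * s = 1 -> antidiag_mx k s *m antidiag_mx k s = 1%:M.
Proof.
move=> ss1; apply/matrixP => i j; rewrite antidiag_mulmx 2!mxE antidiag_mxE rev_ordK.
by rewrite mulrnAr ss1 [RHS]mxE eq_sym.
Qed.

Lemma cconj_antidiag_mx k s : cconj_mx (antidiag_mx k s) = antidiag_mx k s^*%C.
Proof. by apply/matrixP => i j; rewrite !mxE !antidiag_entryE; case: ifP; rewrite ?conjc0. Qed.

Lemma scale_antidiag_mx k a s : a *: antidiag_mx k s = antidiag_mx k (a * s).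
Proof. by apply/matrixP => i j; rewrite [LHS]mxE !antidiag_mxE mulrnAr. Qed.

Lemma antidiag_jordan_mx k a s :
  antidiag_mx k s *m jordan_mx k a = adj_mx (jordan_mx k a^*%C) *m antidiag_mx k s.
Proof.
rewrite /adj_mx cconj_jordan_mx conjcK antidiag_mulmx mulmx_antidiag; congr (_ *: _).
apply/matrixP => i j; rewrite !mxE /jordan_entry /=.
have := ltn_ord i; have := ltn_ord j => lt_jk lt_ik.
have -> : (k - i.+1 == j)%N = (k - j.+1 == i)%N by lia.
by have -> : (j == (k - i.+1).+1 :> nat) = (i == (k - j.+1).+1 :> nat) by lia.
Qed.

Definition offdiag_mx k (Q : 'M[C]_k) : 'M_(k + k) := block_mx 0 Q Q 0.

Lemma offdiag_mx_antidiag k s : offdiag_mx (antidiag_mx k s) = antidiag_mx (k + k) s.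
Proof.
apply/matrixP => i j; rewrite [RHS]mxE antidiag_entryE.
case: (split_ordP i) => i' ->; case: (split_ordP j) => j' ->;
  rewrite ?block_mxEul ?block_mxEur ?block_mxEdl ?block_mxEdr !mxE ?antidiag_entryE /=;
  have := ltn_ord i'; have := ltn_ord j'; do ![case: ifPn] => //=; lia.
Qed.

Lemma sgn_mul e : sgn R e * sgn R e = 1.
Proof. by case: e; rewrite /sgn ?mulrNN mulr1. Qed.

Lemma conjc_sgn e : (sgn R e)^*%C = sgn R e.
Proof. by case: e; rewrite /sgn ?rmorphN /= ?conjc1. Qed.

Lemma sgn_neq0 e : sgn R e != 0.
Proof. by case: e; rewrite /sgn ?oppr_eq0 oner_neq0. Qed.

Lemma sgn_gt0 e : (0 < sgn R e) = e.
Proof. by case: e; rewrite /sgn ?ltr01 // oppr_gt0 ltr10. Qed.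

End JordanMatrix.

Section BlockLists.
Variable R : realType.
Local Notation C := (R[i]).
Implicit Types (s : seq (nat * (nat -> nat -> C))) (cf : seq (cblock R)).

Lemma bd_entry_cat s1 s2 i j (k := sumn (unzip1 s1)) :
  bd_entry (s1 ++ s2) i j =
  if (i < k)%N && (j < k)%N then bd_entry s1 i j
  else if (k <= i)%N && (k <= j)%N then bd_entry s2 (i - k) (j - k) else 0.
Proof.
rewrite {}/k; elim: s1 i j => [|[k f] s1 IH] i j /=; first by rewrite !subn0.
rewrite IH !subnDA; set K := sumn _.
do ![case: ifPn => ?] => //; lia.
Qed.

Lemma bdiag_cat k1 k2 s1 s2 : sumn (unzip1 s1) = k1 ->
  bdiag (k1 + k2) (s1 ++ s2) = dsum_mx (bdiag k1 s1) (bdiag k2 s2).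
Proof.
move=> <-; rewrite /dsum_mx; apply/matrixP => i j; rewrite mxE bd_entry_cat.
case: (split_ordP i) => i' ->; case: (split_ordP j) => j' ->;
  rewrite ?block_mxEul ?block_mxEur ?block_mxEdl ?block_mxEdr mxE ?addKn;
  have := ltn_ord i'; have := ltn_ord j'; do ![case: ifPn] => //=; rewrite ?addKn; lia.
Qed.

Lemma bdiag1 k f : bdiag k [:: (k, f)] = \matrix_(i < k, j < k) f i j :> 'M[C]_k.
Proof. by apply/matrixP => i j; rewrite !mxE /= !ltn_ord. Qed.

Definition cf_size cf : nat := sumn (map (@cb_size R) cf).
Definition cf_jordan_mx k cf : 'M[C]_k := bdiag k (cf_M cf).
Definition cf_jordan_mx' k cf : 'M[C]_k := bdiag k (cf_M' cf).
Definition cf_form_mx k cf : 'M[C]_k := bdiag k (cf_N cf).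

Lemma cf_size_cat cf1 cf2 : cf_size (cf1 ++ cf2) = (cf_size cf1 + cf_size cf2)%N.
Proof. by rewrite /cf_size map_cat sumn_cat. Qed.

Lemma perm_cf_size cf1 cf2 : perm_eq cf1 cf2 -> cf_size cf1 = cf_size cf2.
Proof. by move=> eq12; apply/perm_sumn/perm_map. Qed.

Lemma sumn_unzip1_flatten (f : cblock R -> seq (nat * (nat -> nat -> C))) cf :
  (forall b, sumn (unzip1 (f b)) = cb_size b) -> sumn (unzip1 (flatten (map f cf))) = cf_size cf.
Proof.
move=> size_f; elim: cf => //= b cf IH.
by rewrite /unzip1 map_cat sumn_cat -!/(unzip1 _) IH size_f.
Qed.

Lemma bdiag_flatten_cat (f : cblock R -> seq (nat * (nat -> nat -> C))) k1 k2 cf1 cf2 :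
  (forall b, sumn (unzip1 (f b)) = cb_size b) -> cf_size cf1 = k1 ->
  bdiag (k1 + k2) (flatten (map f (cf1 ++ cf2))) =
  dsum_mx (bdiag k1 (flatten (map f cf1))) (bdiag k2 (flatten (map f cf2))).
Proof. by move=> size_f <-; rewrite map_cat flatten_cat bdiag_cat // sumn_unzip1_flatten. Qed.

Lemma cf_jordan_mx_cat k1 k2 cf1 cf2 : cf_size cf1 = k1 ->
  cf_jordan_mx (k1 + k2) (cf1 ++ cf2) = dsum_mx (cf_jordan_mx k1 cf1) (cf_jordan_mx k2 cf2).
Proof. by apply: bdiag_flatten_cat => -[[[k l] e]|[[k x] y]] /=; lia. Qed.

Lemma cf_jordan_mx'_cat k1 k2 cf1 cf2 : cf_size cf1 = k1 ->
  cf_jordan_mx' (k1 + k2) (cf1 ++ cf2) = dsum_mx (cf_jordan_mx' k1 cf1) (cf_jordan_mx' k2 cf2).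
Proof. by apply: bdiag_flatten_cat => -[[[k l] e]|[[k x] y]] /=; lia. Qed.

Lemma cf_form_mx_cat k1 k2 cf1 cf2 : cf_size cf1 = k1 ->
  cf_form_mx (k1 + k2) (cf1 ++ cf2) = dsum_mx (cf_form_mx k1 cf1) (cf_form_mx k2 cf2).
Proof. by apply: bdiag_flatten_cat => -[[[k l] e]|[[k x] y]] /=; lia. Qed.

Lemma cf_jordan_mx_real k l e : cf_jordan_mx k [:: inl (k, l, e)] = jordan_mx k l%:C%C.
Proof. exact: bdiag1. Qed.

Lemma cf_form_mx_real k l e : cf_form_mx k [:: inl (k, l, e)] = antidiag_mx k (sgn R e).
Proof. exact: bdiag1. Qed.

Lemma cf_jordan_mx_pair k (x y : R) :
  cf_jordan_mx (k + k) [:: inr (k, x, y)] =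
  dsum_mx (jordan_mx k (x +i* y)%C) (jordan_mx k (x -i* y)%C).
Proof. by rewrite /cf_jordan_mx /cf_M /= -cat1s bdiag_cat ?bdiag1 //= addn0. Qed.

Lemma cf_form_mx_pair k (x y : R) :
  cf_form_mx (k + k) [:: inr (k, x, y)] = offdiag_mx (antidiag_mx k 1).
Proof. by rewrite offdiag_mx_antidiag /cf_form_mx /cf_N /= -addnn bdiag1. Qed.

Lemma cf_mx_ind (P : forall k, 'M[C]_k -> 'M[C]_k -> Prop) :
    P 0%N 0 0 ->
    (forall k l e, P k (jordan_mx k l%:C%C) (antidiag_mx k (sgn R e))) ->
    (forall k a, P (k + k)%N (dsum_mx (jordan_mx k a) (jordan_mx k a^*%C))
       (offdiag_mx (antidiag_mx k 1))) ->
    (forall k1 k2 M1 M2 H1 H2,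
       P k1 M1 H1 -> P k2 M2 H2 -> P (k1 + k2)%N (dsum_mx M1 M2) (dsum_mx H1 H2)) ->
  forall k cf, cf_size cf = k -> P k (cf_jordan_mx k cf) (cf_form_mx k cf).
Proof.
move=> P0 Preal Ppair Psum k cf <-{k}; elim: cf => [|b cf IH].
  by rewrite [cf_jordan_mx _ _]flatmx0 [cf_form_mx _ _]flatmx0.
rewrite -cat1s cf_size_cat cf_jordan_mx_cat // cf_form_mx_cat //; apply: Psum => //.
case: b => [[[k l] e]|[[k x] y]]; rewrite /cf_size /= addn0.
  by rewrite cf_jordan_mx_real cf_form_mx_real.
by rewrite -addnn cf_jordan_mx_pair cf_form_mx_pair; apply: Ppair.
Qed.

Lemma cf_form_mx_sqr k cf : cf_size cf = k -> cf_form_mx k cf *m cf_form_mx k cf = 1%:M.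
Proof.
apply: (cf_mx_ind (P := fun k _ H => H *m H = 1%:M)) => {k cf} [|k _ e|k _|k1 k2 _ _ H1 H2 sq1 sq2].
- by rewrite [LHS]flatmx0 [RHS]flatmx0.
- exact/antidiag_mx_sqr/sgn_mul.
- by rewrite offdiag_mx_antidiag; apply/antidiag_mx_sqr/mulr1.
- by rewrite mulmx_dsum sq1 sq2 dsum_scalar_mx.
Qed.

Lemma cf_form_mx_unit k cf : cf_size cf = k -> cf_form_mx k cf \in unitmx.
Proof. by move/cf_form_mx_sqr/mulmx1_unit => []. Qed.

Lemma cconj_cf_form_mx k cf : cf_size cf = k -> cconj_mx (cf_form_mx k cf) = cf_form_mx k cf.
Proof.
apply: (cf_mx_ind (P := fun k _ H => cconj_mx H = H)) => {k cf} [|k _ e|k _|k1 k2 _ _ H1 H2 r1 r2].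
- exact: raddf0.
- by rewrite cconj_antidiag_mx conjc_sgn.
- by rewrite offdiag_mx_antidiag cconj_antidiag_mx conjc1.
- by rewrite cconj_dsum_mx r1 r2.
Qed.

Lemma cf_form_mx_hermitian k cf : cf_size cf = k -> is_hermitian_mx (cf_form_mx k cf).
Proof.
apply: (cf_mx_ind (P := fun k _ H => is_hermitian_mx H)) => {k cf}
  [|k _ e|k _|k1 k2 _ _ H1 H2 herm1 herm2]; rewrite /is_hermitian_mx.
- exact: raddf0.
- by rewrite /adj_mx cconj_antidiag_mx tr_antidiag_mx conjc_sgn.
- by rewrite offdiag_mx_antidiag /adj_mx cconj_antidiag_mx tr_antidiag_mx conjc1.
- by rewrite adj_dsum_mx herm1 herm2.
Qed.

Lemma cf_jordan_mx_selfadjoint k cf : cf_size cf = k ->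
  H_selfadjoint (cf_form_mx k cf) (cf_jordan_mx k cf).
Proof.
apply: (cf_mx_ind (P := fun k M H => H_selfadjoint H M)) => {k cf} [|k l e|k a|*].
- by rewrite /H_selfadjoint [LHS]flatmx0 [RHS]flatmx0.
- by rewrite /H_selfadjoint antidiag_jordan_mx conjc_real.
- rewrite /H_selfadjoint adj_dsum_mx /offdiag_mx !mulmx_block.
  by rewrite !mulmx0 !mul0mx !addr0 !add0r !antidiag_jordan_mx conjcK.
- exact: dsum_selfadjoint.
Qed.

Lemma cf_jordan_mx'E k cf : cf_size cf = k -> cf_jordan_mx' k cf = cconj_mx (cf_jordan_mx k cf).
Proof.
move=> <-{k}; elim: cf => [|b cf IH]; first by rewrite [LHS]flatmx0 [RHS]flatmx0.
rewrite -cat1s cf_size_cat cf_jordan_mx_cat // cf_jordan_mx'_cat // cconj_dsum_mx IH.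
congr (dsum_mx _ _); case: b => [[[k l] e]|[[k x] y]]; rewrite /cf_size /= addn0.
  rewrite cf_jordan_mx_real cconj_jordan_mx conjc_real; exact: bdiag1.
rewrite -addnn cf_jordan_mx_pair cconj_dsum_mx !cconj_jordan_mx /cf_jordan_mx' /cf_M' /= -cat1s.
by rewrite bdiag_cat ?bdiag1 /conjc ?opprK //= addn0.
Qed.

End BlockLists.

(** * Reductions to canonical block lists *)

Section Reduction.
Variable R : realType.
Local Notation C := (R[i]).
Implicit Types (cf : seq (cblock R)).

Definition reduction p k (M H : 'M[C]_p) (W : 'M[C]_(p, k)) cf : Prop :=
  cf_size cf = k /\ pair_embedding M H W (cf_jordan_mx k cf) (cf_form_mx k cf).

Lemma real_reduction p k (M H : 'M_p) (W : 'M_(p, k)) (l : R) e :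
  M *m W = W *m jordan_mx k l%:C%C -> gram H W W = antidiag_mx k (sgn R e) ->
  reduction M H W [:: inl (k, l, e)].
Proof.
move=> MW HW; split; first exact: addn0.
by rewrite cf_jordan_mx_real cf_form_mx_real.
Qed.

Lemma pair_reduction p k (M H : 'M_p) (U V : 'M_(p, k)) (a : C) : is_hermitian_mx H ->
  M *m U = U *m jordan_mx k a -> M *m V = V *m jordan_mx k a^*%C ->
  gram H U U = 0 -> gram H V V = 0 -> gram H V U = antidiag_mx k 1 ->
  reduction M H (row_mx U V) [:: inr (k, complex.Re a, complex.Im a)].
Proof.
move=> hermH MU MV UU VV VU; split; first by rewrite /cf_size /= addn0 addnn.
rewrite cf_jordan_mx_pair cf_form_mx_pair; split.
  by rewrite mul_mx_row MU MV mul_row_dsum_mx; case: (a).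
rewrite gram_row_mx UU VV VU -(adj_gram hermH V U) VU.
by rewrite /adj_mx cconj_antidiag_mx conjc1 tr_antidiag_mx.
Qed.

Lemma reduction_nil p (M H : 'M_p) : reduction M H (0 : 'M_(p, 0)) [::].
Proof. by split=> //; split; rewrite ?thinmx0 // [LHS]flatmx0 [RHS]flatmx0. Qed.

Lemma reduction_cat p k l (M H : 'M_p) (W : 'M_(p, k)) (W' : 'M_(p, l)) cf cf' :
  is_hermitian_mx H -> reduction M H W cf -> reduction M H W' cf' -> gram H W W' = 0 ->
  reduction M H (row_mx W W') (cf ++ cf').
Proof.
move=> hermH [sz embW] [sz' embW'] WW'; split; first by rewrite cf_size_cat sz sz'.
by rewrite cf_jordan_mx_cat // cf_form_mx_cat //; apply: pair_embedding_row_mx.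
Qed.

Lemma reduction_row_mx p k l (M H : 'M_p) (W : 'M_(p, k)) (W' : 'M_(p, l)) cf cf' :
  cf_size cf = k -> reduction M H (row_mx W W') (cf ++ cf') ->
  [/\ reduction M H W cf, reduction M H W' cf' & gram H W W' = 0].
Proof.
move=> sz [/eqP]; rewrite cf_size_cat sz eqn_add2l => /eqP sz' [].
rewrite cf_jordan_mx_cat // cf_form_mx_cat // mul_mx_row mul_row_dsum_mx => /eq_row_mx [MW MW'].
by rewrite gram_row_mx => /eq_block_mx [HW WW' _ HW'].
Qed.

Lemma reduction_comp p k l (M H : 'M_p) (W : 'M_(p, k)) (M' H' : 'M_k) (T : 'M_(k, l)) cf :
  pair_embedding M H W M' H' -> reduction M' H' T cf -> reduction M H (W *m T) cf.
Proof. by move=> embW [sz embT]; split=> //; apply: pair_embedding_comp embW embT. Qed.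

Lemma reduction_dsum p q k l (M1 H1 : 'M_p) (M2 H2 : 'M_q) (W1 : 'M_(p, k)) (W2 : 'M_(q, l))
    cf1 cf2 :
  reduction M1 H1 W1 cf1 -> reduction M2 H2 W2 cf2 ->
  reduction (dsum_mx M1 M2) (dsum_mx H1 H2) (dsum_mx W1 W2) (cf1 ++ cf2).
Proof.
move=> [sz1 emb1] [sz2 emb2]; split; first by rewrite cf_size_cat sz1 sz2.
by rewrite cf_jordan_mx_cat // cf_form_mx_cat //; apply: pair_embedding_dsum.
Qed.

Lemma reduction_catCA p k1 k2 k3 (M H : 'M_p) (W1 : 'M_(p, k1)) (W2 : 'M_(p, k2))
    (W3 : 'M_(p, k3)) cf1 cf2 cf3 :
  is_hermitian_mx H -> cf_size cf1 = k1 -> cf_size cf2 = k2 ->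
  reduction M H (row_mx W1 (row_mx W2 W3)) (cf1 ++ cf2 ++ cf3) ->
  reduction M H (row_mx W2 (row_mx W1 W3)) (cf2 ++ cf1 ++ cf3).
Proof.
move=> hermH sz1 sz2 /(reduction_row_mx sz1) [red1 /(reduction_row_mx sz2) [red2 red3 orth23]].
rewrite gram_row_mxr -row_mx0 => /eq_row_mx [orth12 orth13].
apply: reduction_cat => //; first exact: reduction_cat.
by rewrite gram_row_mxr (gram_eq0_sym hermH orth12) orth23 row_mx0.
Qed.

Lemma reduction_perm p k (M H : 'M_p) cf cf' : is_hermitian_mx H -> perm_eq cf cf' ->
  (exists W : 'M_(p, k), reduction M H W cf) -> exists W : 'M_(p, k), reduction M H W cf'.
Proof.
move=> hermH; move: cf cf'.
apply: (@catCA_perm_ind _ (fun cf => exists W : 'M_(p, k), reduction M H W cf)).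
move=> s1 s2 s3 [W redW]; case: (redW) => sz _.
move: sz W redW; rewrite !cf_size_cat => <- W.
rewrite -[W]hsubmxK -[rsubmx W]hsubmxK => /(reduction_catCA hermH erefl erefl).
by move: (row_mx _ _); rewrite [(cf_size s2 + _)%N]addnCA => W' red; exists W'.
Qed.

Lemma reduction_flip p k (M H : 'M[C]_p) (W : 'M_(p, k + k)) (x y : R) :
  reduction M H W [:: inr (k, x, y)] ->
  exists T : 'M_(k + k), reduction M H (W *m T) [:: inr (k, x, - y)].
Proof.
case=> _ embW; exists (block_mx 0 1%:M 1%:M 0); apply: reduction_comp embW _.
split; first by rewrite /cf_size /= addn0 addnn.
rewrite !cf_jordan_mx_pair !cf_form_mx_pair opprK; split.
  move: (jordan_mx k _) (jordan_mx k _) => J J'.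
  by rewrite !mulmx_block !mul1mx !mulmx1 !mulmx0 !mul0mx !addr0 !add0r.
move: (antidiag_mx k 1) => Q; rewrite /gram adj_block_mx !raddf0 !adj_mx1.
by rewrite /offdiag_mx !mulmx_block !mul1mx !mulmx1 !mulmx0 !mul0mx !addr0 !add0r.
Qed.

Lemma reduction_split p k (M H : 'M[C]_p) (W : 'M_(p, k + k)) (x : R) :
  reduction M H W [:: inr (k, x, 0)] ->
  exists T : 'M_(k + k), reduction M H (W *m T) [:: inl (k, x, true); inl (k, x, false)].
Proof.
case=> _ embW; pose c : C := (sqrtC 2%:R)^-1.
have c_real : c^*%C = c by apply/CrealP; rewrite realV ger0_real // sqrtC_ge0 ler0n.
have cc2 : c * c * 2%:R = 1 by rewrite -expr2 exprVn sqrtCK mulVf // pnatr_eq0.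
exists (c *: block_mx 1%:M 1%:M 1%:M (- 1%:M)); apply: reduction_comp embW _.
split; first by rewrite /cf_size /= addn0.
have size1 e : cf_size [:: inl (k, x, e)] = k by exact: addn0.
rewrite -[[:: inl _; _]]cat1s (cf_jordan_mx_cat _ _ (size1 _)) (cf_form_mx_cat _ _ (size1 _)).
rewrite !cf_jordan_mx_real !cf_form_mx_real cf_jordan_mx_pair cf_form_mx_pair oppr0; split.
  move: (jordan_mx k _) => J; rewrite -scalemxAr -scalemxAl !mulmx_block.
  by rewrite !(mulmx0, mul0mx, mulmxN, mulNmx, mulmx1, mul1mx, addr0, add0r).
have -> : antidiag_mx k (sgn R false) = - antidiag_mx k 1.
  by rewrite -scaleN1r scale_antidiag_mx mulr1.
rewrite [sgn R true]/1; move: (antidiag_mx k 1) => Q.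
rewrite /gram adj_mxZ c_real -!scalemxAl -scalemxAr scalerA.
rewrite adj_block_mx raddfN /= !adj_mx1.
rewrite /offdiag_mx !mulmx_block !(mulmx0, mulmxN, mulNmx, mulmx1, mul1mx, addr0, add0r).
rewrite subrr addNr scale_block_mx !scaler0 -opprD -mulr2n -scaler_nat scalerN scalerA cc2.
by rewrite scale1r.
Qed.

End Reduction.

(** * Jordan chains *)

Section Chain.
Variable R : realType.
Local Notation C := (R[i]).

Lemma H_adjoint_shift p (H M' M : 'M[C]_p) a :
  H_adjoint H M' M -> H_adjoint H (shift_mx M' a^*%C) (shift_mx M a).
Proof.
move=> HM; rewrite /H_adjoint mulmxBr raddfB /= mulmxBl adj_scalar_mx conjcK.
by rewrite HM scalar_mxC.
Qed.

Lemma shift_jordan_unit_col k (a : C) j : (j < k)%N ->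
  shift_mx (jordan_mx k a) a *m unit_col C k j = if (0 < j)%N then unit_col C k j.-1 else 0.
Proof.
move=> lt_jk; rewrite (mul_unit_col _ lt_jk); apply/colP => i; rewrite !mxE /jordan_entry.
rewrite -val_eqE /=; case: posnP => [->|j_gt0]; rewrite !mxE.
  by case: (i == 0 :> nat)%N; rewrite ?subrr ?subr0.
have -> : (j == i.+1) = (i == j.-1 :> nat) by lia.
case: eqP => [->|_]; last by rewrite subr0; case: eqP.
by rewrite subrr gtn_eqF // prednK.
Qed.

Lemma shiftX_jordan_unit_col k (a : C) i j : (j < k)%N ->
  shift_mx (jordan_mx k a) a ^+ i *m unit_col C k j =
  if (i <= j)%N then unit_col C k (j - i) else 0.
Proof.
move=> lt_jk; elim: i => [|i IH]; first by rewrite mulmx_expr0 subn0.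
rewrite -mulmx_exprS IH; case: (leqP i j) => le_ij; last by rewrite mulmx0 ltnNge (ltnW le_ij).
rewrite shift_jordan_unit_col ?(leq_ltn_trans (leq_subr _ _)) // subn_gt0.
by case: ifP; rewrite ?subnS.
Qed.

Lemma ip_antidiag_unit_col k s i j : (i < k)%N -> (j < k)%N ->
  ip (antidiag_mx k s) (unit_col C k i) (unit_col C k j) = if (i + j == k.-1)%N then s else 0.
Proof.
move=> lt_ik lt_jk; rewrite -[unit_col C k i]mul1mx -[unit_col C k j]mul1mx !mul_unit_col -gramE.
by rewrite /gram adj_mx1 mul1mx mulmx1 mxE antidiag_entryE.
Qed.

Lemma chain_jordan p k (M : 'M[C]_p) a x : shift_mx M a ^+ k *m x = 0 ->
  M *m chain k (shift_mx M a) x = chain k (shift_mx M a) x *m jordan_mx k a.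
Proof.
move=> Nkx; apply/col_matrixP => j; have lt_jk := ltn_ord j.
have -> : j = Ordinal lt_jk by apply: val_inj.
rewrite -mulmx_col col_chain (mulmx_shift M a) mulmx_exprS.
rewrite -[RHS]mul_unit_col -mulmxA (mulmx_shift (jordan_mx k a) a) shift_jordan_unit_col //.
rewrite mulmxDr -scalemxAr mul_unit_col col_chain; congr (_ + _) => /=.
case: posnP => [j0|j_gt0]; first by rewrite mulmx0 (mulmx_expr_eq0 Nkx) // j0; lia.
have lt_j1k : (j.-1 < k)%N by lia.
by rewrite (mul_unit_col _ lt_j1k) col_chain /=; congr (_ ^+ _ *m _); lia.
Qed.

Section ChainGram.
Variables (p k : nat) (H N' N : 'M[C]_p) (x z : 'cV[C]_p).

Lemma gram_chain s : H_adjoint H N' N -> N ^+ k *m x = 0 ->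
  (forall i, (i < k)%N -> ip H z (N ^+ i *m x) = if i == k.-1 then s else 0) ->
  gram H (chain k N' z) (chain k N x) = antidiag_mx k s.
Proof.
move=> HN Nkx ip_zNx; apply/matrixP => i j; rewrite gramE !col_chain mxE antidiag_entryE.
rewrite (ip_adjoint _ _ (H_adjointX _ HN)) mulmx_exprD.
have := ltn_ord i; have := ltn_ord j; case: (ltnP (k.-1 - i + (k.-1 - j)) k) => [lt_k|le_k] *.
  by rewrite ip_zNx //; do 2?case: eqP => //; lia.
by rewrite (mulmx_expr_eq0 Nkx) // ip0r; case: eqP => //; lia.
Qed.

Lemma gram_chain_eq0 :
  (forall i j, ip H (N' ^+ i *m z) (N ^+ j *m x) = 0) -> gram H (chain k N' z) (chain k N x) = 0.
Proof. by move=> ip0; apply/matrixP => i j; rewrite gramE !col_chain ip0 mxE. Qed.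

End ChainGram.

Lemma real_chain_reduction p k (M H : 'M[C]_p) (l : R) e x (N := shift_mx M l%:C%C) :
  H_selfadjoint H M -> N ^+ k *m x = 0 ->
  (forall i, (i < k)%N -> ip H x (N ^+ i *m x) = if i == k.-1 then sgn R e else 0) ->
  reduction M H (chain k N x) [:: inl (k, l, e)].
Proof.
move=> HM Nkx ip_xNx; apply: real_reduction; first exact: chain_jordan.
by apply: gram_chain => //; have := H_adjoint_shift l%:C%C HM; rewrite conjc_real.
Qed.

Lemma pair_chain_reduction p k (M H : 'M[C]_p) a x z (N := shift_mx M a) (N' := shift_mx M a^*%C) :
  is_hermitian_mx H -> H_selfadjoint H M -> N ^+ k *m x = 0 -> N' ^+ k *m z = 0 ->
  (forall i, (i < k)%N -> ip H z (N ^+ i *m x) = if i == k.-1 then 1 else 0) ->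
  (forall i j, ip H (N ^+ i *m x) (N ^+ j *m x) = 0) ->
  (forall i j, ip H (N' ^+ i *m z) (N' ^+ j *m z) = 0) ->
  reduction M H (row_mx (chain k N x) (chain k N' z)) [:: inr (k, complex.Re a, complex.Im a)].
Proof.
move=> hermH HM Nkx N'kz ip_zNx ip_xx ip_zz.
apply: pair_reduction => //;
  [exact: chain_jordan|exact: chain_jordan|exact: gram_chain_eq0|exact: gram_chain_eq0|].
by apply: gram_chain => //; apply: H_adjoint_shift.
Qed.

End Chain.

(** * Normalization of Jordan chains *)

Section Normalization.
Variable R : realType.
Local Notation C := (R[i]).
Variables (p : nat) (P N : 'M[C]_p).
Hypothesis PN : comm_mx P N.

(* The corrections [x + c N^s x], s = 1, 2, ..., fix the moments one at a time from the top. *)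
Lemma moments_normalize k (S : {pred C}) (moment : 'cV[C]_p -> nat -> C) (alpha beta sigma : C)
    (x : 'cV_p) :
  alpha * sigma != 0 ->
  (forall y i, N ^+ i *m y = 0 -> moment y i = 0) ->
  (forall c y i s, c \in S -> moment (y + c *: (N ^+ s *m y)) i =
     moment y i + alpha * c * moment y (i + s)%N + beta * c ^+ 2 * moment y (i + s + s)%N) ->
  (forall y i, - (moment y i / (alpha * sigma)) \in S) ->
  P *m x = x -> N ^+ k *m x = 0 -> moment x k.-1 = sigma ->
  exists x', [/\ P *m x' = x', N ^+ k *m x' = 0 &
    forall i, (i < k)%N -> moment x' i = if i == k.-1 then sigma else 0].
Proof.
move=> as_neq0 moment0 moment_step S_coef Px Nkx moment_x.
suff /(_ k.-1) [x' [Px' Nkx' moment_x']] : forall s, exists x',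
    [/\ P *m x' = x', N ^+ k *m x' = 0 &
       forall i, (k.-1 - s <= i)%N -> moment x' i = if i == k.-1 then sigma else 0].
  by exists x'; split=> // i _; rewrite moment_x' // subnn.
have moment_ge y i : N ^+ k *m y = 0 -> (k <= i)%N -> moment y i = 0.
  by move=> Nky le_ki; apply/moment0/mulmx_expr_eq0/le_ki.
elim=> [|s [x' [Px' Nkx' moment_x']]].
  exists x; split=> // i; rewrite subn0; case: eqP => [-> //|i_neq le_i].
  by apply: moment_ge => //; lia.
have [le_ks|lt_sk] := leqP k.-1 s.
  by exists x'; split=> // i le_i; apply: moment_x'; lia.
pose c := - (moment x' (k.-1 - s.+1)%N / (alpha * sigma)).
exists (x' + c *: (N ^+ s.+1 *m x')); split.
- by rewrite mulmxDr -scalemxAr mulmxA (comm_mxX _ PN) -mulmxA Px'.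
- by rewrite mulmxDr -scalemxAr mulmx_exprD addnC -mulmx_exprD Nkx' mulmx0 scaler0 addr0.
move=> i le_i; rewrite moment_step; last exact: S_coef.
rewrite [X in _ + X](_ : _ = 0) ?addr0; last by rewrite moment_ge ?mulr0 //; lia.
have [le_si|lt_is] := leqP (k.-1 - s) i.
  by rewrite [moment x' (_ + _)%N]moment_ge ?mulr0 ?addr0 ?moment_x' //; lia.
have -> : i = (k.-1 - s.+1)%N by lia.
rewrite [moment x' (_ + _)%N]moment_x'; last by lia.
rewrite subnK // eqxx ltn_eqF; last by lia.
by rewrite mulrAC mulrN mulrCA mulfV // mulr1 subrr.
Qed.

Variable H : 'M[C]_p.

Lemma pair_normalize k (x z : 'cV_p) :
  P *m x = x -> N ^+ k *m x = 0 -> ip H z (N ^+ k.-1 *m x) != 0 ->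
  exists x', [/\ P *m x' = x', N ^+ k *m x' = 0 &
    forall i, (i < k)%N -> ip H z (N ^+ i *m x') = if i == k.-1 then 1 else 0].
Proof.
set c := ip H z _ => Px Nkx c_neq0.
apply: (@moments_normalize k predT (fun y i => ip H z (N ^+ i *m y)) 1 0 1 (c^-1 *: x)) => //=.
- by rewrite mulr1 oner_neq0.
- by move=> y i ->; rewrite ip0r.
- by move=> a y i s _; rewrite mulmxDr -scalemxAr ipDr ipZr mulmx_exprD !mul0r mul1r addr0.
- by rewrite -scalemxAr Px.
- by rewrite -scalemxAr Nkx scaler0.
- by rewrite -scalemxAr ipZr mulVf.
Qed.

Hypothesis hermH : is_hermitian_mx H.
Hypothesis HN : H_selfadjoint H N.

Lemma ip_selfadjoint_real i (x : 'cV_p) : ip H x (N ^+ i *m x) \is Num.real.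
Proof.
apply/CrealP; apply: etrans (ipC hermH _ _) _.
exact: ip_adjoint (H_selfadjointX i HN).
Qed.

Lemma real_normalize k (x : 'cV_p) :
  P *m x = x -> N ^+ k *m x = 0 -> ip H x (N ^+ k.-1 *m x) != 0 ->
  exists x', [/\ P *m x' = x', N ^+ k *m x' = 0 &
    forall i, (i < k)%N -> ip H x' (N ^+ i *m x') =
      if i == k.-1 then sgn R (0 < ip H x (N ^+ k.-1 *m x)) else 0].
Proof.
set c := ip H x _ => Px Nkx c_neq0.
have c_real : c \is Num.real by apply: ip_selfadjoint_real.
pose d := (sqrtC `|c|)^-1.
have d_real : d^*%C = d by apply/CrealP; rewrite realV ger0_real // sqrtC_ge0 normr_ge0.
have two_neq0 : 2%:R != 0 :> C by rewrite pnatr_eq0.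
apply: (@moments_normalize k Num.real (fun y i => ip H y (N ^+ i *m y)) 2%:R 1 _ (d *: x)) => /=.
- by rewrite mulf_neq0 ?sgn_neq0.
- by move=> y i ->; rewrite ip0r.
- move=> a y i s /CrealP a_real.
  rewrite mulmxDr -scalemxAr ipDr !ipDl !ipZl !ipZr [a^*%C]a_real !mulmx_exprD.
  by rewrite !(ip_adjoint _ _ (H_selfadjointX s HN)) !mulmx_exprD !(addnC s); ring.
- move=> y i; rewrite realN realM ?ip_selfadjoint_real // realV realM ?realn //.
  by apply/CrealP; apply: conjc_sgn.
- by rewrite -scalemxAr Px.
- by rewrite -scalemxAr Nkx scaler0.
rewrite -scalemxAr ipZr ipZl d_real mulrA -expr2 exprVn sqrtCK -/c /sgn.
case: (real_ltgt0P c_real) => c_sgn; first by rewrite mulVf.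
  by rewrite invrN mulNr mulVf.
by rewrite c_sgn eqxx in c_neq0.
Qed.

End Normalization.

(** * Existence of Jordan chains *)

Lemma nonincreasing_stationary (f : nat -> nat) :
  (forall k, f k.+1 <= f k)%N -> exists k, f k.+1 = f k.
Proof.
move=> f_le; have [n] := ubnP (f 0%N); elim: n f f_le => // n IH f f_le f0_lt.
have [eq10|neq10] := eqVneq (f 1%N) (f 0%N); first by exists 0%N.
have [|k eqk] := IH (f \o succn) (fun k => f_le k.+1); last by exists k.+1.
by have := f_le 0%N; move: neq10 f0_lt => /=; lia.
Qed.

Lemma nsubmx_witness (F : fieldType) a b c (A : 'M[F]_(a, c)) (B : 'M_(b, c)) :
  ~~ (A <= B)%MS -> exists u : 'cV_c, B *m u = 0 /\ A *m u != 0.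
Proof.
rewrite submxE => AB_neq0.
have [j Aj_neq0] : exists j, A *m col j (cokermx B) != 0.
  apply/existsP; apply: contraNT AB_neq0 => /existsPn Acol0.
  by apply/eqP/col_matrixP => j; have /eqP := negPn (Acol0 j); rewrite mulmx_col col0.
by exists (col j (cokermx B)); rewrite mulmx_col mulmx_coker col0.
Qed.

Lemma kernel_stationary (F : fieldType) q (N P : 'M[F]_q) (v : 'cV_q) :
  P *m P = P -> v != 0 -> P *m v = v -> N *m v = 0 ->
  exists k (x : 'cV_q),
    [/\ (0 < k)%N, P *m x = x, N ^+ k *m x = 0, N ^+ k.-1 *m x != 0 &
     forall y : 'cV_q, P *m y = y -> N ^+ k.+1 *m y = 0 -> N ^+ k *m y = 0].
Proof.
move=> PP v_neq0 Pv Nv; pose f k := \rank (N ^+ k *m P).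
have f_le k : (f k.+1 <= f k)%N by rewrite /f -mulmx_exprS mxrankM_maxr.
have f_stationary : exists k, f k.+1 == f k.
  by have [k /eqP eqk] := nonincreasing_stationary f_le; exists k.
case: (ex_minnP f_stationary) => k /eqP eqk kmin.
have stab (y : 'cV_q) : P *m y = y -> N ^+ k.+1 *m y = 0 -> N ^+ k *m y = 0.
  move=> Py Nk1y; have sub : (N ^+ k.+1 *m P <= N ^+ k *m P)%MS by rewrite -mulmx_exprS submxMl.
  have /andP[_ /submxP[D NkP]] : (N ^+ k.+1 *m P == N ^+ k *m P)%MS.
    by rewrite -(mxrank_leqif_eq sub) -/(f _) -/(f _) eqk.
  by rewrite -Py mulmxA NkP -!mulmxA Py Nk1y mulmx0.
have k_gt0 : (0 < k)%N.
  rewrite lt0n; apply: contra_neqN v_neq0 => /eqP k0; move: stab; rewrite k0 => /(_ v Pv).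
  by rewrite mulmx_expr0 expr1; apply.
have /nsubmx_witness[u [Nku Nk1u]] : ~~ (N ^+ k.-1 *m P <= N ^+ k *m P)%MS.
  apply: contraT; rewrite negbK => /mxrankS; rewrite -/(f _) -/(f _) => f_le_k.
  by have := kmin k.-1; have := f_le k.-1; rewrite prednK //; lia.
by exists k, (P *m u); split=> //; rewrite mulmxA ?PP.
Qed.

Lemma stable_eigenvector (F : numClosedFieldType) q (A P : 'M[F]_q) :
  comm_mx A P -> P *m P = P -> P != 0 ->
  exists a (v : 'cV_q), [/\ v != 0, P *m v = v & A *m v = a *: v].
Proof.
move=> AP PP P_neq0.
have stab : stablemx P^T A^T by rewrite -trmx_mul AP trmx_mul submxMl.
have rank_gt0 : (0 < \rank P^T)%N by rewrite lt0n mxrank_eq0 trmx_eq0.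
have [b /eigenvalueP[w wb w_neq0]] := eigenvalue_closed (restrictmx P^T A^T) rank_gt0.
set u := w *m row_base P^T.
have /eigenvectorP[a /eigenspaceP uA] : stablemx u A^T.
  by rewrite -stablemx_restrict // wb scalemx_sub.
exists a, u^T; split.
- by rewrite trmx_eq0 mulmx_free_eq0 // row_base_free.
- have /submxP[y ->] : (u <= P^T)%MS.
    by apply: submx_trans (submxMl _ _) _; rewrite eq_row_base.
  by rewrite trmx_mul trmxK mulmxA PP.
- by apply: trmx_inj; rewrite trmx_mul trmxK uA linearZ /= trmxK.
Qed.

Section SelfadjointForm.
Variable R : realType.
Local Notation C := (R[i]).
Variables (q : nat) (A H : 'M[C]_q).
Hypothesis HA : H_selfadjoint H A.

Lemma root_vectors_orthogonal a b i j (x y : 'cV_q) : b != a^*%C ->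
  shift_mx A a ^+ i *m x = 0 -> shift_mx A b ^+ j *m y = 0 -> ip H x y = 0.
Proof.
move=> ab_neq; have [s] := ubnP (i + j); elim: s i j x y => // s IH [|i] [|j] x y lt_s;
  rewrite ?mulmx_expr0 => Nx Ny; rewrite ?Nx ?Ny ?ip0l ?ip0r //.
have Nx_y : ip H (shift_mx A a *m x) y = 0.
  by apply: (IH i j.+1); rewrite ?mulmx_exprSr //; lia.
have x_Ny : ip H x (shift_mx A b *m y) = 0.
  by apply: (IH i.+1 j); rewrite ?mulmx_exprSr //; lia.
have /eqP := ip_adjoint x y HA; rewrite (mulmx_shift A a) (mulmx_shift A b).
rewrite ipDl ipDr Nx_y x_Ny !add0r ipZl ipZr -subr_eq0 -mulrBl mulf_eq0 subr_eq0 eq_sym.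
by rewrite (negPf ab_neq) => /eqP.
Qed.

Hypothesis hermH : is_hermitian_mx H.

Lemma polarization (N : 'M[C]_q) x y : H_selfadjoint H N -> ip H y (N *m x) != 0 ->
  exists a b, ip H (a *: x + b *: y) (N *m (a *: x + b *: y)) != 0.
Proof.
move=> HN; set c := ip H y _ => c_neq0.
have [xx|xx] := eqVneq (ip H x (N *m x)) 0; last first.
  by exists 1, 0; rewrite scale1r scale0r addr0.
have [yy|yy] := eqVneq (ip H y (N *m y)) 0; last first.
  by exists 0, 1; rewrite scale1r scale0r add0r.
have xy : ip H x (N *m y) = c^*%C by rewrite -(ip_adjoint _ _ HN) -(ipC hermH).
exists c^-1, 1; rewrite scale1r mulmxDr -scalemxAr ipDl !ipDr !ipZl !ipZr xx yy xy -/c.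
by rewrite !mulr0 add0r addr0 mulVf // conjc_inv mulVf ?conjc_eq0 // -mulr2n pnatr_eq0.
Qed.

Variable P : 'M[C]_q.
Hypothesis uH : H \in unitmx.
Hypothesis AP : comm_mx A P.
Hypothesis PP : P *m P = P.
Hypothesis HP : H_selfadjoint H P.
Hypothesis P_neq0 : P != 0.

(* If w = N^(k-1) x were orthogonal to the kernel of the adjoint of N^k, it would lie in the
   image of N^k, against the choice of k as the index where the kernels become stable. *)
Lemma dual_jordan_vectors : exists (a : C) k (x y : 'cV_q),
  [/\ (0 < k)%N, P *m x = x /\ P *m y = y, shift_mx A a ^+ k *m x = 0,
     shift_mx A a^*%C ^+ k *m y = 0 & ip H y (shift_mx A a ^+ k.-1 *m x) != 0].
Proof.
have [a [v [v_neq0 Pv Av]]] := stable_eigenvector AP PP P_neq0.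
have PN b : comm_mx P (shift_mx A b) by apply/comm_mx_shift/comm_mx_sym.
have Nv : shift_mx A a *m v = 0.
  by apply: (addIr (a *: v)); rewrite -mulmx_shift Av add0r.
have [k [x [k_gt0 Px Nkx]]] := kernel_stationary PP v_neq0 Pv Nv.
set w := _ *m x => w_neq0 stab.
have /nsubmx_witness[y [N'ky wy_neq0]] : ~~ (adj_mx w *m H <= shift_mx A a^*%C ^+ k)%MS.
  apply: contra_neqN w_neq0 => /submxP[D wH].
  have : adj_mx w = D *m invmx H *m adj_mx (shift_mx A a ^+ k).
    apply: (can_inj (mulmxK uH)); rewrite wH -!mulmxA.
    have := H_adjointX k (H_adjoint_shift a^*%C HA); rewrite conjcK => <-.
    by rewrite !mulmxA mulmxKV.
  move/(congr1 (@adj_mx R _ _)); rewrite adj_mxK [in RHS]adj_mxM adj_mxK.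
  set u := adj_mx _ => w_u.
  have w_Pu : w = shift_mx A a ^+ k *m (P *m u).
    by rewrite mulmxA -(comm_mxX _ (PN a)) -mulmxA -w_u mulmxA (comm_mxX _ (PN a)) -mulmxA Px.
  rewrite w_Pu; apply: stab; first by rewrite mulmxA PP.
  by rewrite -mulmx_exprS -w_Pu mulmx_exprS prednK.
exists a, k, x, (P *m y); split=> //.
- by rewrite mulmxA PP.
- by rewrite mulmxA -(comm_mxX _ (PN _)) -mulmxA N'ky mulmx0.
rewrite (ip_adjoint _ _ HP) mulmxA (comm_mxX _ (PN _)) -mulmxA Px -(ipC hermH) conjc_eq0.
by apply: contra wy_neq0 => /eqP wy0; apply/eqP/colP => i; rewrite ord1 [RHS]mxE.
Qed.

End SelfadjointForm.

(** * Quaternionic frames *)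

Section Quaternionic.
Variable R : realType.
Local Notation C := (R[i]).
Variable n : nat.

Definition Jq : 'M[C]_(n + n) := block_mx 0 (- 1%:M) 1%:M 0.

Lemma cconj_Jq : cconj_mx Jq = Jq.
Proof. by rewrite cconj_block_mx !(raddf0, raddfN) /= cconj_scalar_mx conjc1. Qed.

Lemma adj_Jq : adj_mx Jq = - Jq.
Proof. by rewrite adj_block_mx opp_block_mx !(raddf0, raddfN) /= adj_mx1 opprK. Qed.

Lemma Jq_sqr : Jq *m Jq = - 1%:M.
Proof.
rewrite mulmx_block !(mulmx0, mul0mx, addr0, add0r) mulmx1 mul1mx.
by rewrite scalar_mx_block opp_block_mx oppr0.
Qed.

Definition qconj k (W : 'M[C]_(n + n, k)) : 'M_(n + n, k) := Jq *m cconj_mx W.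

Definition qspan k (W : 'M[C]_(n + n, k)) : 'M_(n + n, k + k) := row_mx W (qconj W).

Lemma qconjK k (W : 'M_(n + n, k)) : qconj (qconj W) = - W.
Proof. by rewrite /qconj cconj_mxM cconj_Jq cconj_mxK mulmxA Jq_sqr mulNmx mul1mx. Qed.

Lemma qconjM k l (W : 'M_(n + n, k)) (T : 'M_(k, l)) : qconj (W *m T) = qconj W *m cconj_mx T.
Proof. by rewrite /qconj cconj_mxM mulmxA. Qed.

Lemma qconj_row_mx k l (W : 'M_(n + n, k)) (W' : 'M_(n + n, l)) :
  qconj (row_mx W W') = row_mx (qconj W) (qconj W').
Proof. by rewrite /qconj cconj_row_mx mul_mx_row. Qed.

Lemma col_qconj k (W : 'M_(n + n, k)) j : col j (qconj W) = qconj (col j W).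
Proof. by rewrite -mulmx_col; congr (_ *m _); apply/colP => i; rewrite !mxE. Qed.

Lemma in_OmegaP (A : 'M[C]_(n + n)) : in_Omega A <-> A *m Jq = Jq *m cconj_mx A.
Proof.
split=> [[A1 [A2 ->]]|].
  rewrite cconj_block_mx !mulmx_block !(mulmx0, mul0mx) !(mulmxN, mulNmx) !(mulmx1, mul1mx).
  by rewrite !(addr0, add0r) !raddfN /= !cconj_mxK !opprK.
rewrite -[A]submxK; move: (ulsubmx A) (ursubmx A) (dlsubmx A) (drsubmx A) => a b c d.
rewrite cconj_block_mx !mulmx_block !(mulmx0, mul0mx) !(mulmxN, mulNmx) !(mulmx1, mul1mx).
rewrite !(addr0, add0r) => /eq_block_mx [-> _ -> _].
by exists a, (- c); rewrite raddfN /= opprK.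
Qed.

Lemma Omega_qconj A k (W : 'M_(n + n, k)) : in_Omega A -> A *m qconj W = qconj (A *m W).
Proof. by move/in_OmegaP => AJ; rewrite /qconj cconj_mxM !mulmxA AJ. Qed.

Lemma Omega_mul (A B : 'M[C]_(n + n)) : in_Omega A -> in_Omega B -> in_Omega (A *m B).
Proof.
move=> /in_OmegaP AJ /in_OmegaP BJ; apply/in_OmegaP.
by rewrite -mulmxA BJ mulmxA AJ cconj_mxM mulmxA.
Qed.

Lemma Omega_inv (A : 'M[C]_(n + n)) : A \in unitmx -> in_Omega A -> in_Omega (invmx A).
Proof.
move=> uA /in_OmegaP AJ; apply/in_OmegaP; apply: (can_inj (mulKmx uA)).
rewrite (mulKVmx uA) mulmxA AJ -mulmxA -cconj_mxM (mulmxV uA).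
by rewrite [cconj_mx _]cconj_scalar_mx conjc1 mulmx1.
Qed.

Lemma in_Omega_qspanP (S : 'M[C]_(n + n)) : in_Omega S <-> exists W : 'M_(n + n, n), S = qspan W.
Proof.
have qspanE (a b : 'M_n) : qspan (col_mx a b) = block_mx a (- cconj_mx b) b (cconj_mx a).
  rewrite block_mxEh /qspan /qconj cconj_col_mx mul_block_col !mul0mx add0r addr0 mulNmx.
  by rewrite !mul1mx.
split=> [[A1 [A2 ->]]|[W ->]].
  by exists (col_mx A1 (- A2)); rewrite qspanE raddfN /= opprK.
exists (usubmx W), (- dsubmx W).
by rewrite -{1}[W]vsubmxK qspanE raddfN /= opprK.
Qed.

Lemma shiftX_qconj A a i k (x : 'M_(n + n, k)) : in_Omega A ->
  shift_mx A a ^+ i *m qconj x = qconj (shift_mx A a^*%C ^+ i *m x).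
Proof.
move=> OA; have shift_qconj (y : 'M_(n + n, k)) :
    shift_mx A a *m qconj y = qconj (shift_mx A a^*%C *m y).
  rewrite {1}/qconj mulmxBl (Omega_qconj y OA) /qconj mulmxBl raddfB /= mulmxBr.
  by rewrite [cconj_mx (_%:M *m _)]cconj_mxM cconj_scalar_mx conjcK !mulmxA scalar_mxC.
elim: i => [|i IH]; first by rewrite !mulmx_expr0.
by rewrite -[LHS]mulmx_exprS IH shift_qconj mulmx_exprS.
Qed.

Section QuaternionicForm.
Variable H : 'M[C]_(n + n).
Hypothesis OH : in_Omega H.

Lemma gram_qconj k l (U : 'M_(n + n, k)) (W : 'M_(n + n, l)) :
  gram H (qconj U) (qconj W) = cconj_mx (gram H U W).
Proof.
rewrite /gram -mulmxA (Omega_qconj W OH) /qconj adj_mxM adj_Jq adj_cconj_mx.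
rewrite mulmxN mulNmx -mulmxA (mulmxA Jq) Jq_sqr mulNmx mul1mx mulmxN opprK.
by rewrite !cconj_mxM cconj_adj_mx mulmxA.
Qed.

Lemma gram_qconjl k l (U : 'M_(n + n, k)) (W : 'M_(n + n, l)) :
  gram H (qconj U) W = - cconj_mx (gram H U (qconj W)).
Proof. by rewrite -gram_qconj qconjK /gram mulmxN opprK. Qed.

Definition qframe A k (W : 'M[C]_(n + n, k)) (cf : seq (cblock R)) : Prop :=
  reduction A H W cf /\ gram H W (qconj W) = 0.

Section QFrame.
Variables (A : 'M[C]_(n + n)) (k : nat) (W : 'M[C]_(n + n, k)) (cf : seq (cblock R)).
Hypothesis OA : in_Omega A.
Hypothesis frameW : qframe A W cf.

Lemma qspan_embedding :
  pair_embedding A H (qspan W)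
    (dsum_mx (cf_jordan_mx k cf) (cconj_mx (cf_jordan_mx k cf)))
    (dsum_mx (cf_form_mx k cf) (cf_form_mx k cf)).
Proof.
have [[sz [AW HW]] W_qW] := frameW; split.
  by rewrite mul_mx_row mul_row_dsum_mx (Omega_qconj W OA) AW qconjM.
by rewrite gram_row_mx gram_qconj gram_qconjl HW W_qW raddf0 oppr0 cconj_cf_form_mx.
Qed.

Lemma qspan_gram_unit : gram H (qspan W) (qspan W) \in unitmx.
Proof.
have [_ ->] := qspan_embedding; have [[sz _] _] := frameW.
suff /mulmx1_unit[] : dsum_mx (cf_form_mx k cf) (cf_form_mx k cf) *m
  dsum_mx (cf_form_mx k cf) (cf_form_mx k cf) = 1%:M by [].
by rewrite mulmx_dsum cf_form_mx_sqr // dsum_scalar_mx.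
Qed.

End QFrame.

Lemma canonical_reductionP A (S : 'M_(n + n)) cf : in_Omega A ->
  canonical_reduction A H S cf <->
  exists W : 'M_(n + n, n), [/\ S = qspan W, qframe A W cf & all (@cb_valid R) cf].
Proof.
move=> OA; split=> [[/in_Omega_qspanP[W SW] uS valid sz [AS HS]]|[W [SW frameW valid]]].
  exists W; split=> //; move: AS HS; rewrite SW => AS.
  rewrite -[LHS]/(gram H (qspan W) (qspan W)) gram_row_mx => /eq_block_mx [HW W_qW _ _].
  split=> //; split=> //; split=> //.
  have {}AS : A *m qspan W = qspan W *m dsum_mx (cf_jordan_mx n cf) (cf_jordan_mx' n cf).
    by rewrite -[dsum_mx _ _]AS !mulmxA mulmxV -?SW // mul1mx.
  by move: AS; rewrite mul_mx_row mul_row_dsum_mx => /eq_row_mx [].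
have [AS HS] := qspan_embedding OA frameW; have [[sz _] _] := frameW.
have uS : S \in unitmx.
  have := qspan_gram_unit OA frameW; rewrite /gram -SW !unitmx_mul.
  by case/andP.
split=> //; first by apply/in_Omega_qspanP; exists W.
split; last by rewrite SW; exact: HS.
by rewrite -mulmxA SW AS -SW mulKmx // -cf_jordan_mx'E.
Qed.

Hypothesis hermH : is_hermitian_mx H.

Lemma gram_qconj_skew k l (U : 'M_(n + n, k)) (W : 'M_(n + n, l)) :
  (gram H U (qconj W))^T = - gram H W (qconj U).
Proof.
by rewrite -cconj_adj_mx adj_gram // gram_qconjl raddfN /= cconj_mxK.
Qed.

Lemma ip_qconj_skew x y : ip H x (qconj y) = - ip H y (qconj x).
Proof. by rewrite /ip -[gram H x _]trmxK gram_qconj_skew !mxE. Qed.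

Variable A : 'M[C]_(n + n).
Hypothesis OA : in_Omega A.
Hypothesis HA : H_selfadjoint H A.

Lemma ip_chain_qconj a i j x :
  ip H (shift_mx A a ^+ i *m x) (qconj (shift_mx A a ^+ j *m x)) = 0.
Proof.
have adj_shiftX b s u v :
    ip H (shift_mx A b ^+ s *m u) v = ip H u (shift_mx A b^*%C ^+ s *m v).
  by apply: ip_adjoint; apply: H_adjointX; have := H_adjoint_shift b^*%C HA; rewrite conjcK.
rewrite adj_shiftX (shiftX_qconj _ _ _ OA) conjcK mulmx_exprD; set s := (i + j)%N.
have skew : ip H x (qconj (shift_mx A a ^+ s *m x)) = - ip H x (qconj (shift_mx A a ^+ s *m x)).
  by rewrite {1}ip_qconj_skew adj_shiftX (shiftX_qconj _ _ _ OA) conjcK.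
by apply/eqP; rewrite -eqNr -skew.
Qed.

Lemma gram_chain_qconj a b k l x z :
  (forall i j, ip H (shift_mx A a ^+ i *m x) (qconj (shift_mx A b ^+ j *m z)) = 0) ->
  gram H (chain k (shift_mx A a) x) (qconj (chain l (shift_mx A b) z)) = 0.
Proof.
by move=> ip0; apply/matrixP => i j; rewrite gramE col_qconj !col_chain ip0 mxE.
Qed.

Lemma qframe_cat k l (W : 'M_(n + n, k)) (W' : 'M_(n + n, l)) cf cf' :
  qframe A W cf -> qframe A W' cf' -> gram H (qspan W) W' = 0 ->
  qframe A (row_mx W W') (cf ++ cf').
Proof.
move=> [redW W_qW] [redW' W'_qW']; rewrite gram_row_mxl -col_mx0 => /eq_col_mx [WW'].
rewrite gram_qconjl => /eqP; rewrite oppr_eq0 => /eqP qWW'.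
have W_qW' : gram H W (qconj W') = 0 by rewrite -[LHS]cconj_mxK qWW' raddf0.
have W'_qW : gram H W' (qconj W) = 0.
  by rewrite -[LHS]opprK -gram_qconj_skew W_qW' trmx0 oppr0.
split; first exact: reduction_cat.
by rewrite qconj_row_mx gram_row_mx W_qW W'_qW' W_qW' W'_qW block_mx0.
Qed.

Section StableFrame.
Variable P : 'M[C]_(n + n).
Hypothesis AP : comm_mx A P.

Lemma real_chain_qframe (l : R) k x y (N := shift_mx A l%:C%C) :
  P *m x = x -> P *m y = y -> N ^+ k *m x = 0 -> N ^+ k *m y = 0 ->
  ip H y (N ^+ k.-1 *m x) != 0 ->
  exists (W : 'M_(n + n, k)) e, P *m W = W /\ qframe A W [:: inl (k, l, e)].
Proof.
move=> Px Py Nkx Nky yNx.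
have PN : comm_mx P N by apply/comm_mx_shift/comm_mx_sym.
have HN : H_selfadjoint H N by have := H_adjoint_shift l%:C%C HA; rewrite conjc_real.
have [b [c]] := polarization hermH (H_selfadjointX k.-1 HN) yNx; set u := _ + _ => uNu.
have Pu : P *m u = u by rewrite mulmxDr -!scalemxAr Px Py.
have Nku : N ^+ k *m u = 0 by rewrite mulmxDr -!scalemxAr Nkx Nky !scaler0 addr0.
have [z [Pz Nkz ip_zNz]] := real_normalize PN hermH HN Pu Nku uNu.
exists (chain k N z); eexists; split; first exact: mul_chain.
split; first exact: real_chain_reduction ip_zNz.
by apply: gram_chain_qconj => i j; apply: ip_chain_qconj.
Qed.

Lemma pair_chain_qframe (a : C) k x y (N := shift_mx A a) (N' := shift_mx A a^*%C) :
  a^*%C != a -> P *m x = x -> P *m y = y -> N ^+ k *m x = 0 -> N' ^+ k *m y = 0 ->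
  ip H y (N ^+ k.-1 *m x) != 0 ->
  exists W : 'M_(n + n, k + k),
    P *m W = W /\ qframe A W [:: inr (k, complex.Re a, complex.Im a)].
Proof.
move=> a_nonreal Px Py Nkx N'ky yNx.
have PN b : comm_mx P (shift_mx A b) by apply/comm_mx_shift/comm_mx_sym.
have [z [Pz Nkz ip_yNz]] := pair_normalize (PN a) Px Nkx yNx.
have root b i u : shift_mx A b ^+ k *m u = 0 -> shift_mx A b ^+ k *m (shift_mx A b ^+ i *m u) = 0.
  by move=> Nku; rewrite mulmx_exprD addnC -mulmx_exprD Nku mulmx0.
have a_ne : a != a^*%C by rewrite eq_sym.
have orth_zy i j : ip H (N ^+ i *m z) (qconj (N' ^+ j *m y)) = 0.
  apply: (root_vectors_orthogonal (i := k) (j := k) HA a_ne); first exact: root.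
  by rewrite shiftX_qconj // root // /qconj raddf0 mulmx0.
exists (row_mx (chain k N z) (chain k N' y)); split.
  by rewrite mul_mx_row !(mul_chain _ (PN _)).
split.
  apply: pair_chain_reduction => // i j.
    by apply: (root_vectors_orthogonal (i := k) (j := k) HA a_ne); apply: root.
  have a_ne' : a^*%C != a^*%C^*%C by rewrite conjcK.
  by apply: (root_vectors_orthogonal (i := k) (j := k) HA a_ne'); apply: root.
rewrite qconj_row_mx gram_row_mx -block_mx0; congr block_mx.
- by apply: gram_chain_qconj => i j; apply: ip_chain_qconj.
- exact: gram_chain_qconj.
- by rewrite -[LHS]opprK -gram_qconj_skew gram_chain_qconj // trmx0 oppr0.
- by apply: gram_chain_qconj => i j; apply: ip_chain_qconj.
Qed.

Lemma stable_qframe : P *m P = P -> H_selfadjoint H P -> H \in unitmx -> P != 0 ->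
  exists k (W : 'M_(n + n, k)) cf,
    [/\ (0 < k)%N, P *m W = W, qframe A W cf & all (@cb_valid R) cf].
Proof.
move=> PP HP uH P_neq0.
have [a [k [x [y [k_gt0 [Px Py] Nkx N'ky yNx]]]]] :=
  dual_jordan_vectors HA hermH uH AP PP HP P_neq0.
have [a_real|a_nonreal] := eqVneq a^*%C a.
  have aE : a = (complex.Re a)%:C%C.
    by move: a_real; case: (a) => u v [] /eqP; rewrite eqNr => /eqP ->.
  move: Nkx N'ky yNx; rewrite a_real aE => Nkx Nky yNx.
  have [W [e [PW frameW]]] := real_chain_qframe Px Py Nkx Nky yNx.
  by exists k, W, [:: inl (k, complex.Re a, e)]; rewrite /= k_gt0.
wlog Im_gt0 : a x y Px Py Nkx N'ky yNx a_nonreal / 0 < complex.Im a.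
  move=> wlog_Im; have [Im_gt0|Im_lt0|Im0] := ltgtP 0 (complex.Im a); first exact: (wlog_Im a x y).
    apply: (wlog_Im a^*%C y x Py Px N'ky); rewrite ?conjcK; first exact: Nkx.
    - rewrite -(ipC hermH) conjc_eq0; apply: contra yNx => /eqP yNx0; apply/eqP.
      rewrite -yNx0; apply/esym/ip_adjoint/H_adjointX.
      exact: H_adjoint_shift.
    - by rewrite eq_sym.
    - by move: Im_lt0; case: (a) => u v /=; rewrite oppr_gt0.
  by case/eqP: a_nonreal; move: Im0; case: (a) => u v /= <-; rewrite /conjc oppr0.
have [W [PW frameW]] := pair_chain_qframe a_nonreal Px Py Nkx N'ky yNx.
exists (k + k)%N, W, [:: inr (k, complex.Re a, complex.Im a)].
by split=> //=; rewrite ?k_gt0 ?Im_gt0 // addn_gt0 k_gt0.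
Qed.

End StableFrame.

Hypothesis uH : H \in unitmx.

Lemma qframe_leq k (W : 'M_(n + n, k)) cf : qframe A W cf -> (k <= n)%N.
Proof. by move=> frameW; have := gram_unit_leq (qspan_gram_unit OA frameW); lia. Qed.

Lemma qframe_extend k (W : 'M_(n + n, k)) cf : (k < n)%N -> qframe A W cf ->
  all (@cb_valid R) cf ->
  exists k' (W' : 'M_(n + n, k')) cf', [/\ (k < k')%N, qframe A W' cf' & all (@cb_valid R) cf'].
Proof.
move=> lt_kn frameW valid; pose P := orth_proj H (qspan W).
have uG := qspan_gram_unit OA frameW; have [AS _] := qspan_embedding OA frameW.
have P_neq0 : P != 0 by apply: orth_proj_neq0; lia.
have [l [W' [cf' [l_gt0 PW' frameW' valid']]]] :=
  stable_qframe (orth_proj_comm uG HA AS) (orth_proj_idem uG)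
    (orth_proj_selfadjoint uG hermH) uH P_neq0.
exists (k + l)%N, (row_mx W W'), (cf ++ cf'); split; last by rewrite all_cat valid.
  by rewrite -addn1 leq_add2l.
by apply: qframe_cat => //; rewrite -PW' gram_mulr gram_orth_proj // mul0mx.
Qed.

Lemma qframe_exists : exists (W : 'M_(n + n, n)) cf, qframe A W cf /\ all (@cb_valid R) cf.
Proof.
suff extend d k (W : 'M_(n + n, k)) cf : (n - k <= d)%N -> qframe A W cf ->
    all (@cb_valid R) cf -> exists (W : 'M_(n + n, n)) cf, qframe A W cf /\ all (@cb_valid R) cf.
  apply: (extend n 0%N 0 [::]); rewrite ?leq_subr //.
  by split; [exact: reduction_nil|exact: flatmx0].
elim: d k W cf => [|d IH] k W cf le_d frameW valid; have le_kn := qframe_leq frameW.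
  by have eq_kn : k = n by [lia]; subst k; exists W, cf.
have [lt_kn|le_nk] := ltnP k n; last by have eq_kn : k = n by [lia]; subst k; exists W, cf.
have [k' [W' [cf' [lt_kk' frameW' valid']]]] := qframe_extend lt_kn frameW valid.
by apply: (IH k' W' cf') => //; lia.
Qed.

End QuaternionicForm.
End Quaternionic.

(** * Powers of invertible Jordan blocks *)

Section InvertiblePower.
Variable R : realType.
Local Notation C := (R[i]).

Lemma shift_expr_jordan_top k (a : C) m (x := unit_col C k k.-1)
    (N := shift_mx (jordan_mx k a ^+ m) (a ^+ m)) : (0 < k)%N ->
  N ^+ k *m x = 0 /\ N ^+ k.-1 *m x = (a ^+ m.-1 *+ m) ^+ k.-1 *: unit_col C k 0.
Proof.
move=> k_gt0; have lt_k1k : (k.-1 < k)%N by rewrite prednK.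
have /shift_expr_jordan_vector : shift_mx (jordan_mx k a) a ^+ k *m x = 0.
  by rewrite shiftX_jordan_unit_col // leqNgt lt_k1k.
by rewrite [in X in _ -> X]/x shiftX_jordan_unit_col // leqnn subnn; apply.
Qed.

Lemma expr_mulrn_neq0 (F : numDomainType) (a : F) m j :
  (0 < m)%N -> a != 0 -> (a ^+ m.-1 *+ m) ^+ j != 0.
Proof.
by move=> m_gt0 a_neq0; rewrite expf_neq0 // mulrn_eq0 negb_or -lt0n m_gt0 expf_neq0.
Qed.

Lemma real_jordan_power k (l : R) e m : (0 < k)%N -> l != 0 -> (0 < m)%N ->
  exists (W : 'M[C]_k) e',
    reduction (jordan_mx k l%:C%C ^+ m) (antidiag_mx k (sgn R e)) W [:: inl (k, l ^+ m, e')] /\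
    (0 < l ^+ m.-1 -> e' = e).
Proof.
move=> k_gt0 l_neq0 m_gt0; set H := antidiag_mx k _.
have lt_k1k : (k.-1 < k)%N by rewrite prednK.
have size1 : cf_size [:: inl (k, l, e)] = k by apply: addn0.
have hermH : is_hermitian_mx H by have := cf_form_mx_hermitian size1; rewrite cf_form_mx_real.
have HM : H_selfadjoint H (jordan_mx k l%:C%C ^+ m).
  apply: H_selfadjointX; have := cf_jordan_mx_selfadjoint size1.
  by rewrite cf_form_mx_real cf_jordan_mx_real.
have lm : l%:C%C ^+ m = (l ^+ m)%:C%C by rewrite rmorphXn.
have [] := shift_expr_jordan_top l%:C%C m k_gt0; rewrite lm.
set N := shift_mx _ _; set x := unit_col C k _ => Nkx Nk1x.
have HN : H_selfadjoint H N by have := H_adjoint_shift (l ^+ m)%:C%C HM; rewrite conjc_real.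
have xNx : ip H x (N ^+ k.-1 *m x) = ((l ^+ m.-1 *+ m) ^+ k.-1)%:C%C * sgn R e.
  by rewrite Nk1x ipZr ip_antidiag_unit_col // addn0 eqxx !(rmorphXn, rmorphMn).
have xNx_neq0 : ip H x (N ^+ k.-1 *m x) != 0.
  by rewrite xNx mulf_neq0 ?sgn_neq0 // fmorph_eq0 expr_mulrn_neq0.
have [x' [_ Nkx' ip_x']] := real_normalize (comm1mx _) hermH HN (mul1mx _) Nkx xNx_neq0.
exists (chain k N x'); eexists; split; first exact: real_chain_reduction ip_x'.
by move=> l_gt0; rewrite xNx pmulr_rgt0 ?sgn_gt0 // ltcR exprn_gt0 // pmulrn_lgt0.
Qed.

Lemma complex_jordan_power k (a : C) m : (0 < k)%N -> a != 0 -> (0 < m)%N ->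
  exists U V : 'M[C]_k,
    [/\ jordan_mx k a ^+ m *m U = U *m jordan_mx k (a ^+ m),
        jordan_mx k a^*%C ^+ m *m V = V *m jordan_mx k (a ^+ m)^*%C &
        gram (antidiag_mx k 1) V U = antidiag_mx k 1].
Proof.
move=> k_gt0 a_neq0 m_gt0; have lt_k1k : (k.-1 < k)%N by rewrite prednK.
have [] := shift_expr_jordan_top a^*%C m k_gt0; rewrite -[_^*%C ^+ m]rmorphXn /=.
set N' := shift_mx _ _ => N'kz _; have [] := shift_expr_jordan_top a m k_gt0.
set N := shift_mx _ _; set z := unit_col C k _ in N'kz * => Nkz Nk1z.
have zNz_neq0 : ip (antidiag_mx k 1) z (N ^+ k.-1 *m z) != 0.
  by rewrite Nk1z ipZr ip_antidiag_unit_col // addn0 eqxx mulr1 expr_mulrn_neq0.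
have [x [_ Nkx ip_zNx]] := pair_normalize (comm1mx _) (mul1mx _) Nkz zNz_neq0.
exists (chain k N x), (chain k N' z).
split; [exact: chain_jordan Nkx|exact: chain_jordan N'kz|].
apply: gram_chain => //; apply/H_adjoint_shift/H_adjointX.
exact: antidiag_jordan_mx.
Qed.

Lemma pair_jordan_power k (a : C) m : (0 < k)%N -> a != 0 -> (0 < m)%N ->
  exists W : 'M[C]_(k + k),
    reduction (dsum_mx (jordan_mx k a) (jordan_mx k a^*%C) ^+ m) (offdiag_mx (antidiag_mx k 1)) W
      [:: inr (k, complex.Re (a ^+ m), complex.Im (a ^+ m))].
Proof.
move=> k_gt0 a_neq0 m_gt0.
have [U [V [JU JV VU]]] := complex_jordan_power k_gt0 a_neq0 m_gt0.
have gram_offdiag (X1 X2 Y1 Y2 : 'M[C]_k) :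
    gram (offdiag_mx (antidiag_mx k 1)) (col_mx X1 X2) (col_mx Y1 Y2) =
    gram (antidiag_mx k 1) X1 Y2 + gram (antidiag_mx k 1) X2 Y1.
  rewrite /gram /adj_mx cconj_col_mx tr_col_mx /offdiag_mx mul_row_block mul_row_col.
  by rewrite !mulmx0 add0r addr0 addrC.
have gram0l (X : 'M[C]_k) : gram (antidiag_mx k 1) 0 X = 0 by rewrite /gram raddf0 !mul0mx.
have gram0r (X : 'M[C]_k) : gram (antidiag_mx k 1) X 0 = 0 by rewrite /gram mulmx0.
exists (row_mx (col_mx U 0) (col_mx 0 V)); rewrite expr_dsum_mx.
apply: pair_reduction; rewrite ?gram_offdiag ?gram0l ?gram0r ?VU ?(addr0, add0r) //.
- by rewrite /is_hermitian_mx offdiag_mx_antidiag /adj_mx cconj_antidiag_mx tr_antidiag_mx conjc1.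
- by rewrite mul_block_col !(mulmx0, mul0mx, addr0) mul_col_mx JU mul0mx.
- by rewrite mul_block_col !(mulmx0, mul0mx, add0r) mul_col_mx JV mul0mx.
Qed.

End InvertiblePower.

(** * Balanced sign sequences *)

Definition balanced_seq (e : bool) s : seq bool := nseq (uphalf s) e ++ nseq s./2 (~~ e).

Lemma size_balanced_seq e s : size (balanced_seq e s) = s.
Proof. by rewrite size_cat !size_nseq uphalf_half -addnA addnn odd_double_half. Qed.

Lemma balanced_seqSS e s :
  perm_eq (balanced_seq e s.+2) (true :: false :: balanced_seq e s).
Proof.
apply/permP => p; case: e; rewrite /balanced_seq /= !count_cat /= !count_nseq;
  by case: (p true); case: (p false) => /=; lia.
Qed.

Lemma balanced_seq_balanced e s : balanced e (balanced_seq e s).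
Proof.
rewrite /balanced size_balanced_seq !count_cat !count_nseq /= eqxx uphalf_half.
by case: e; case: (odd s) => /=; lia.
Qed.

Lemma count_bool (p : pred bool) e s :
  count p s = (p e * count (pred1 e) s + p (~~ e) * count (pred1 (~~ e)) s)%N.
Proof. by elim: s => [|b s IH] /=; [lia|rewrite IH]; case: b; case: (e) => /=; lia. Qed.

Lemma balanced_perm e s : balanced e s -> perm_eq s (balanced_seq e (size s)).
Proof.
have size_count t : size t = (count (pred1 e) t + count (pred1 (~~ e)) t)%N.
  by rewrite -count_predT (count_bool _ e) !mul1n.
have eq_size := size_balanced_seq e (size s); have := balanced_seq_balanced e (size s).
rewrite /balanced eq_size => bal_seq bal_s; apply/permP => p; rewrite !(count_bool p e).
move: bal_seq bal_s; rewrite !size_count in eq_size *.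
by case: ifP => _ /eqP bal_seq /eqP bal_s; congr (_ * _ + _ * _)%N; lia.
Qed.

(** * Powers of nilpotent Jordan blocks *)

Section NilpotentPower.
Variable R : realType.
Local Notation C := (R[i]).
Variables (m k : nat) (e : bool).
Let B : 'M[C]_k := jordan_mx k 0 ^+ m.
Let H : 'M[C]_k := antidiag_mx k (sgn R e).

Lemma antidiag_sgn_hermitian : is_hermitian_mx H.
Proof. by rewrite /is_hermitian_mx /adj_mx cconj_antidiag_mx tr_antidiag_mx conjc_sgn. Qed.

Lemma nilpotent_powerX_unit_col i j : (j < k)%N ->
  B ^+ i *m unit_col C k j = if (m * i <= j)%N then unit_col C k (j - m * i) else 0.
Proof. by move=> lt_jk; rewrite -exprM -[jordan_mx k 0]shift_mx0 shiftX_jordan_unit_col. Qed.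

Definition residue_chain c L : 'M[C]_(k, L.+1) := chain L.+1 B (unit_col C k (c + m * L)).

Lemma col_residue_chain c L t : (c + m * L < k)%N ->
  col t (residue_chain c L) = unit_col C k (c + m * t).
Proof.
move=> lt_k; have le_tL : (t <= L)%N := leq_ord t.
rewrite col_chain nilpotent_powerX_unit_col //= mulnBr -addnBA ?leq_subr // subKn ?leq_mul //.
by rewrite (leq_trans (leq_subr _ _)) ?leq_addl.
Qed.

Lemma residue_chain_jordan c L : (c < m)%N -> (c + m * L < k)%N ->
  B *m residue_chain c L = residue_chain c L *m jordan_mx L.+1 0.
Proof.
move=> lt_cm lt_k; rewrite /residue_chain -[B]shift_mx0 {1}shift_mx0; apply: chain_jordan.
by rewrite shift_mx0 nilpotent_powerX_unit_col // mulnS ltn_geF // ltn_add2r.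
Qed.

Lemma gram_residue_chain c c' L : (0 < m)%N -> (c + c' + 1 + m * L)%N = k ->
  gram H (residue_chain c L) (residue_chain c' L) = antidiag_mx L.+1 (sgn R e).
Proof.
move=> m_gt0 eq_k; apply/matrixP => i j; have := leq_ord i; have := leq_ord j => le_jL le_iL.
have le_m t : (t <= L)%N -> (m * t <= m * L)%N by move=> le_tL; rewrite leq_mul2l le_tL orbT.
have := le_m _ le_iL; have := le_m _ le_jL => le_mj le_mi.
rewrite gramE !col_residue_chain ?ip_antidiag_unit_col; try lia.
rewrite mxE antidiag_entryE; congr (if _ then _ else _).
by rewrite -[RHS](eqn_pmul2l m_gt0) mulnDr /=; lia.
Qed.

Definition residue_supported (D : pred nat) l (W : 'M[C]_(k, l)) : Prop :=
  forall i : 'I_k, ~~ D (i %% m)%N -> row i W = 0.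

Lemma residue_supported_row_mx D l1 l2 (W1 : 'M_(k, l1)) (W2 : 'M_(k, l2)) :
  residue_supported D W1 -> residue_supported D W2 -> residue_supported D (row_mx W1 W2).
Proof. by move=> supp1 supp2 i Di; rewrite row_row_mx supp1 // supp2 // row_mx0. Qed.

Lemma residue_supported_mul D l1 l2 (W : 'M_(k, l1)) (T : 'M_(l1, l2)) :
  residue_supported D W -> residue_supported D (W *m T).
Proof. by move=> suppW i Di; rewrite row_mul suppW // mul0mx. Qed.

Lemma residue_supported_sub (D D' : pred nat) l (W : 'M_(k, l)) :
  subpred D D' -> residue_supported D W -> residue_supported D' W.
Proof. by move=> sDD' suppW i D'i; apply: suppW; apply: contra D'i; apply: sDD'. Qed.

Lemma residue_chain_supported (D : pred nat) c L : (c < m)%N -> (c + m * L < k)%N -> D c ->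
  residue_supported D (residue_chain c L).
Proof.
move=> lt_cm lt_k Dc i Di; apply/rowP => t; rewrite mxE [RHS]mxE.
have /colP/(_ i) := col_residue_chain t lt_k; rewrite !mxE => ->.
case: eqP => // i_eq; case/negP: Di.
by rewrite i_eq addnC mulnC modnMDl modn_small.
Qed.

Lemma residue_supported_orthogonal (D D' : pred nat) l1 l2 (W1 : 'M_(k, l1)) (W2 : 'M_(k, l2)) :
  (forall i j, (i + j)%N = k.-1 -> D (i %% m)%N -> ~~ D' (j %% m)%N) ->
  residue_supported D W1 -> residue_supported D' W2 -> gram H W1 W2 = 0.
Proof.
move=> DD' supp1 supp2; apply/matrixP => s t; rewrite /gram -mulmxA antidiag_mulmx.
rewrite [LHS]mxE [RHS]mxE big1 // => i _; rewrite !mxE.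
have [Di|nDi] := boolP (D (i %% m)%N); last first.
  by have /rowP/(_ s) := supp1 i nDi; rewrite !mxE => ->; rewrite conjc0 mul0r.
have rev_i : (i + rev_ord i)%N = k.-1 by rewrite /=; have := ltn_ord i; lia.
have /rowP/(_ t) := supp2 _ (DD' _ _ rev_i Di); rewrite !mxE => ->.
by rewrite mulr0 mulr0.
Qed.

(* The anti-diagonal i + j = k - 1 reflects a window [lo, lo + s) of residues onto itself. *)
Lemma residue_mirror lo s L i j : (lo + s <= m)%N -> (lo.*2 + s + m * L)%N = k ->
  (i + j)%N = k.-1 -> (lo <= i %% m < lo + s)%N -> (i %% m + j %% m)%N = (lo.*2 + s).-1.
Proof.
move=> le_sm eq_k eq_ij lo_i.
have eq_mod : (i %/ m * m + j = L * m + ((lo.*2 + s).-1 - i %% m))%N.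
  by have := divn_eq i m; lia.
have := congr1 (modn^~ m) eq_mod; rewrite !modnMDl => ->.
by move: (i %% m)%N lo_i => d lo_d; rewrite modn_small; lia.
Qed.

Lemma self_mirror_reduction c L : (c < m)%N -> (c.*2 + 1 + m * L)%N = k ->
  reduction B H (residue_chain c L) [:: inl (L.+1, 0, e)].
Proof.
move=> lt_cm eq_k; apply: real_reduction; first by apply: residue_chain_jordan => //; lia.
by apply: gram_residue_chain; lia.
Qed.

Lemma mirror_pair_reduction lo s L : (lo + s.+2 <= m)%N -> (lo.*2 + s.+2 + m * L)%N = k ->
  reduction B H (row_mx (sgn R e *: residue_chain lo L) (residue_chain (lo + s.+1) L))
    [:: inr (L.+1, 0, 0)].
Proof.
move=> le_sm eq_k.
have isotropic d : (d == lo) || (d == lo + s.+1)%N ->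
    gram H (residue_chain d L) (residue_chain d L) = 0.
  move=> d_eq; have supp_d : residue_supported (pred1 d) (residue_chain d L).
    by apply: residue_chain_supported; rewrite /= ?eqxx //; lia.
  apply: (residue_supported_orthogonal _ supp_d supp_d) => i j eq_ij /= i_d.
  by have := residue_mirror le_sm eq_k eq_ij; lia.
apply: (@pair_reduction _ _ _ _ _ _ _ 0); first exact: antidiag_sgn_hermitian.
- by rewrite -scalemxAr -scalemxAl residue_chain_jordan //; lia.
- by rewrite conjc0 residue_chain_jordan //; lia.
- by rewrite /gram adj_mxZ -scalemxAr -!scalemxAl -/(gram H _ _) isotropic ?eqxx // !scaler0.
- by rewrite isotropic // eqxx orbT.
have mirror_gram :
    gram H (residue_chain (lo + s.+1) L) (residue_chain lo L) = antidiag_mx L.+1 (sgn R e).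
  by apply: gram_residue_chain; lia.
by rewrite /gram -scalemxAr -/(gram H _ _) mirror_gram scale_antidiag_mx sgn_mul.
Qed.

Lemma residue_range_reduction s lo L : (lo + s <= m)%N ->
  (lo.*2 + s + m * L)%N = k ->
  exists l (W : 'M[C]_(k, l)) cf,
    [/\ reduction B H W cf, residue_supported (fun c => lo <= c < lo + s)%N W &
        perm_eq cf [seq inl (L.+1, 0, e') | e' <- balanced_seq e s]].
Proof.
have [n] := ubnP s; elim: n s lo => // n IH [|[|s]] lo lt_sn le_sm eq_k.
- exists 0%N, 0, [::]; split=> //; first exact: reduction_nil.
  by move=> i _; rewrite row0.
- exists L.+1, (residue_chain lo L), [:: inl (L.+1, 0, e)]; split=> //.
    by apply: self_mirror_reduction; lia.
  by apply: residue_chain_supported; lia.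
have [T redT] := reduction_split (mirror_pair_reduction le_sm eq_k).
have [|||l [W [cf [redW suppW perm_cf]]]] := IH s lo.+1; try lia.
have suppT : residue_supported (pred2 lo (lo + s.+1)%N)
    (row_mx (sgn R e *: residue_chain lo L) (residue_chain (lo + s.+1) L) *m T).
  apply/residue_supported_mul/residue_supported_row_mx; first rewrite -mul_mx_scalar.
    by apply/residue_supported_mul/residue_chain_supported; rewrite /= ?eqxx //; lia.
  by apply: residue_chain_supported; rewrite /= ?eqxx ?orbT //; lia.
do 3 eexists; split.
- apply: reduction_cat redT redW _; first exact: antidiag_sgn_hermitian.
  apply: residue_supported_orthogonal suppT suppW => i j eq_ij /= i_lo.
  by have := residue_mirror le_sm eq_k eq_ij; lia.
- apply: residue_supported_row_mx.
    by apply: residue_supported_sub suppT => i /=; lia.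
  by apply: residue_supported_sub suppW => i /=; lia.
- have := perm_map (fun e' => inl (L.+1, 0, e') : cblock R) (balanced_seqSS e s).
  by rewrite perm_sym; apply: perm_trans; rewrite /= !perm_cons.
Qed.

End NilpotentPower.

(** * Block lists of powers *)

Section CanonicalPower.
Variable R : realType.
Local Notation C := (R[i]).
Implicit Types (cf : seq (cblock R)).
Variable m : nat.

(* The source [cf] need not be valid: a block [inr (k, x, y)] may have [y <= 0], so that any
   complex root of an eigenvalue can be used. *)
Definition canonical_power cf cf' : Prop := exists W : 'M[C]_(cf_size cf),
  reduction (cf_jordan_mx _ cf ^+ m) (cf_form_mx _ cf) W cf'.

Lemma canonical_powerP k cf cf' : cf_size cf = k ->
  canonical_power cf cf' <->
  exists W : 'M_k, reduction (cf_jordan_mx k cf ^+ m) (cf_form_mx k cf) W cf'.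
Proof. by move=> <-. Qed.

Lemma canonical_power_real k (l : R) e k' (W : 'M_(k, k')) cf' : cf_size cf' = k ->
  reduction (jordan_mx k l%:C%C ^+ m) (antidiag_mx k (sgn R e)) W cf' ->
  canonical_power [:: inl (k, l, e)] cf'.
Proof.
move=> size_cf' redW; have eq_k : k' = k by case: redW => eq_k' _; rewrite -eq_k'.
subst k'; have size1 : cf_size [:: inl (k, l, e)] = k := addn0 k.
apply/(canonical_powerP _ size1); exists W.
by rewrite cf_jordan_mx_real cf_form_mx_real.
Qed.

Lemma canonical_power_nil : canonical_power [::] [::].
Proof. by exists 0; apply: reduction_nil. Qed.

Lemma canonical_power_cat cf1 cf2 cf1' cf2' :
  canonical_power cf1 cf1' -> canonical_power cf2 cf2' ->
  canonical_power (cf1 ++ cf2) (cf1' ++ cf2').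
Proof.
move=> [W1 red1] [W2 red2]; apply/(canonical_powerP _ (cf_size_cat _ _)).
exists (dsum_mx W1 W2); rewrite cf_jordan_mx_cat // cf_form_mx_cat // expr_dsum_mx.
exact: reduction_dsum.
Qed.

Lemma canonical_power_perm cf cf1 cf2 :
  perm_eq cf1 cf2 -> canonical_power cf cf1 -> canonical_power cf cf2.
Proof. by apply: reduction_perm; apply: cf_form_mx_hermitian. Qed.

Lemma canonical_power_pair k (x y : R) (a := (x +i* y)%C) : (0 < m)%N -> (0 < k)%N -> a != 0 ->
  canonical_power [:: inr (k, x, y)] [:: inr (k, complex.Re (a ^+ m), complex.Im (a ^+ m))].
Proof.
move=> m_gt0 k_gt0 a_neq0; have [W redW] := pair_jordan_power k_gt0 a_neq0 m_gt0.
apply/(canonical_powerP (k := k + k)); first by rewrite /cf_size /= addn0 addnn.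
by exists W; rewrite cf_jordan_mx_pair cf_form_mx_pair.
Qed.

Lemma canonical_power_pair_comp cf k (x y : R) cf' : canonical_power cf [:: inr (k, x, y)] ->
  (forall p (M H : 'M[C]_p) (W : 'M_(p, k + k)), reduction M H W [:: inr (k, x, y)] ->
     exists T : 'M_(k + k), reduction M H (W *m T) cf') ->
  canonical_power cf cf'.
Proof.
move=> [W redW] comp; have eq_k : cf_size cf = (k + k)%N.
  by case: redW => eq_kk _; rewrite -eq_kk /cf_size /= addn0 addnn.
have /(canonical_powerP _ eq_k)[W' /comp[T redT]] : canonical_power cf [:: inr (k, x, y)].
  by exists W.
by apply/(canonical_powerP _ eq_k); exists (W' *m T).
Qed.

Lemma canonical_power_flip cf k (x y : R) :
  canonical_power cf [:: inr (k, x, y)] -> canonical_power cf [:: inr (k, x, - y)].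
Proof. by move/canonical_power_pair_comp; apply=> *; apply: reduction_flip. Qed.

Lemma canonical_power_split cf k (x : R) : canonical_power cf [:: inr (k, x, 0)] ->
  canonical_power cf [:: inl (k, x, true); inl (k, x, false)].
Proof. by move/canonical_power_pair_comp; apply=> *; apply: reduction_split. Qed.

Lemma cf_size_zero_blocks L (s : seq bool) :
  cf_size [seq inl (L, 0, e) : cblock R | e <- s] = (L * size s)%N.
Proof. by elim: s => [|b s IH] /=; rewrite ?muln0 // mulnS -IH. Qed.

Lemma canonical_power_zero a r e : (0 < r <= m)%N ->
  canonical_power [:: inl ((a * m + r)%N, 0, e)]
    (zero_group R a r (balanced_seq e r ++ balanced_seq e (m - r))).
Proof.
move=> /andP[r_gt0 le_rm]; set k := (a * m + r)%N.
have size_zero L s cf : perm_eq cf [seq inl (L, 0, e') | e' <- balanced_seq e s] ->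
    cf_size cf = (L * s)%N.
  by move/perm_cf_size->; rewrite cf_size_zero_blocks size_balanced_seq.
rewrite /zero_group take_size_cat ?size_balanced_seq // drop_size_cat ?size_balanced_seq //.
have eq_k1 : (0.*2 + r + m * a)%N = k by rewrite /k; lia.
have [|k1 [W1 [cf1 [red1 supp1 perm1]]]] := @residue_range_reduction R m k e r 0 a _ eq_k1.
  by [].
case: posnP => [a0|a_gt0].
  rewrite cats0; apply: (canonical_power_perm perm1); apply: canonical_power_real red1.
  by rewrite (size_zero _ _ _ perm1) /k a0; lia.
have eq_k2 : (r.*2 + (m - r) + m * a.-1)%N = k by rewrite /k; case: (a) a_gt0 => // b _; lia.
have [|k2 [W2 [cf2 [red2 supp2 perm2]]]] := @residue_range_reduction R m k e (m - r) r a.-1 _ eq_k2.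
  by rewrite subnKC.
rewrite prednK // in perm2.
apply: (canonical_power_perm (perm_cat perm1 perm2)).
apply: (@canonical_power_real _ _ _ _ (row_mx W1 W2)).
  rewrite cf_size_cat (size_zero _ _ _ perm1) (size_zero _ _ _ perm2) /k mulnBr mulSn.
  by have := leq_mul (leqnn a) le_rm; lia.
rewrite rmorph0; apply: reduction_cat red1 red2 _; first exact: antidiag_sgn_hermitian.
apply: residue_supported_orthogonal supp1 supp2 => i j eq_ij i_r.
by have := residue_mirror (lo := 0) le_rm eq_k1 eq_ij i_r; lia.
Qed.

End CanonicalPower.

(** * Block lists admitting a root *)

Section Roots.
Variable R : realType.
Local Notation C := (R[i]).
Implicit Types (cf : seq (cblock R)).
Variable m : nat.

Definition root_conditions cf : Prop := (~~ odd m -> cond_neg cf) /\ cond_zero m cf.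

Lemma root_conditions_cat cf1 cf2 :
  root_conditions cf1 -> root_conditions cf2 -> root_conditions (cf1 ++ cf2).
Proof.
move=> [neg1 [gs1 [all1 zero1]]] [neg2 [gs2 [all2 zero2]]]; split=> [m_even|].
  have [ts1 [pos1 perm1]] := neg1 m_even; have [ts2 [pos2 perm2]] := neg2 m_even.
  exists (ts1 ++ ts2); split; first by rewrite all_cat pos1.
  by rewrite /neg_part filter_cat map_cat flatten_cat perm_cat.
exists (gs1 ++ gs2); split; first by rewrite all_cat all1.
by rewrite /zero_part filter_cat map_cat flatten_cat perm_cat.
Qed.

Lemma cond_neg_nil cf : neg_part cf = [::] -> cond_neg cf.
Proof. by move=> neg0; exists [::]; rewrite neg0. Qed.

Lemma cond_zero_nil cf : zero_part cf = [::] -> cond_zero m cf.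
Proof. by move=> zero0; exists [::]; rewrite zero0. Qed.

Hypothesis m_gt0 : (0 < m)%N.

Lemma zero_group_block a r eps b : b \in zero_group R a r eps ->
  exists k e, b = inl (k, 0, e) /\ (0 < k)%N.
Proof.
rewrite mem_cat => /orP[/mapP[e _ ->]|]; first by exists a.+1, e.
by case: posnP => // a_gt0 /mapP[e _ ->]; exists a, e.
Qed.

Lemma zero_block_power k e : (0 < k)%N -> exists cf,
  [/\ canonical_power m [:: inl (k, 0, e)] cf, all (@cb_valid R) cf & root_conditions cf].
Proof.
move=> k_gt0; have [a [r [eq_k r_bound]]] : exists a r, k = (a * m + r)%N /\ (0 < r <= m)%N.
  exists (k.-1 %/ m)%N, (k.-1 %% m).+1; rewrite ltn_mod m_gt0; split=> //.
  by have := divn_eq k.-1 m; lia.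
have /andP[r_gt0 le_rm] := r_bound.
pose eps := balanced_seq e r ++ balanced_seq e (m - r); exists (zero_group R a r eps).
split; first by rewrite eq_k; apply: canonical_power_zero.
  by apply/allP => b /zero_group_block[l [e' [-> l_gt0]]].
split=> [_|].
  apply/cond_neg_nil/eqP; rewrite -[_ == _]negbK -has_filter; apply/hasPn => b.
  by move=> /zero_group_block[l [e' [-> _]]]; rewrite ltxx.
exists [:: (a, r, eps)]; split.
  rewrite /= andbT r_gt0 le_rm size_cat !size_balanced_seq subnKC // eqxx /=.
  apply/existsP; exists e; rewrite take_size_cat ?drop_size_cat ?size_balanced_seq //.
  by rewrite !balanced_seq_balanced.
suff -> : zero_part (zero_group R a r eps) = zero_group R a r eps by rewrite /= cats0.
apply/all_filterP/allP => b /zero_group_block[l [e' [-> _]]].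
exact: eqxx.
Qed.

Lemma real_block_power k (l : R) e : (0 < k)%N -> l != 0 -> exists cf,
  [/\ canonical_power m [:: inl (k, l, e)] cf, all (@cb_valid R) cf & root_conditions cf].
Proof.
move=> k_gt0 l_neq0; have [W [e' [redW _]]] := real_jordan_power e k_gt0 l_neq0 m_gt0.
exists [:: inl (k, l ^+ m, e')]; split; rewrite /= ?k_gt0 //.
  by apply: canonical_power_real redW; apply: addn0.
split=> [m_even|].
  by apply: cond_neg_nil; rewrite /neg_part /= ltNge exprn_even_ge0.
by apply: cond_zero_nil; rewrite /zero_part /= expf_eq0 (negPf l_neq0) andbF.
Qed.

Lemma pair_block_power k (x y : R) : (0 < k)%N -> 0 < y -> exists cf,
  [/\ canonical_power m [:: inr (k, x, y)] cf, all (@cb_valid R) cf & root_conditions cf].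
Proof.
move=> k_gt0 y_gt0; have a_neq0 : (x +i* y)%C != 0.
  by rewrite eq_complex negb_and /= (gt_eqF y_gt0) orbT.
have := canonical_power_pair m_gt0 k_gt0 a_neq0; have := expf_neq0 m a_neq0; rewrite eq_complex.
move: (complex.Re _) (complex.Im _) => u v uv_neq0 power.
have nonreal_ok v' : root_conditions [:: inr (k, u, v')].
  by split=> [_|]; [apply: cond_neg_nil|apply: cond_zero_nil].
have [v_lt0|v_gt0|v0] := ltgtP v 0.
- exists [:: inr (k, u, - v)]; split=> //; first exact: canonical_power_flip.
  by rewrite /= k_gt0 oppr_gt0 v_lt0.
- by exists [:: inr (k, u, v)]; split; rewrite /= ?k_gt0 ?v_gt0.
rewrite v0 eqxx andbT in power uv_neq0.
exists [:: inl (k, u, true); inl (k, u, false)]; split; first exact: canonical_power_split.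
  by rewrite /= k_gt0.
split=> [_|]; last by apply: cond_zero_nil; rewrite /zero_part /= (negPf uv_neq0).
have [u_lt0|u_ge0] := ltP u 0; last by apply: cond_neg_nil; rewrite /neg_part /= ltNge u_ge0.
by exists [:: (k, u)]; split; rewrite /neg_part /= ?k_gt0 u_lt0.
Qed.

Lemma canonical_power_exists cf : all (@cb_valid R) cf -> exists cf',
  [/\ canonical_power m cf cf', all (@cb_valid R) cf' & root_conditions cf'].
Proof.
elim: cf => [_|b cf IH /= /andP[valid_b /IH[cf2 [power2 valid2 cond2]]]].
  exists [::]; split=> //; first exact: canonical_power_nil.
  by split=> [_|]; [apply: cond_neg_nil|apply: cond_zero_nil].
have [cf1 [power1 valid1 cond1]] : exists cf1,
    [/\ canonical_power m [:: b] cf1, all (@cb_valid R) cf1 & root_conditions cf1].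
  case: b valid_b => [[[k l] e] k_gt0|[[k x] y] /= /andP[k_gt0 y_gt0]].
    by have [->|l_neq0] := eqVneq l 0; [apply: zero_block_power|apply: real_block_power].
  exact: pair_block_power.
exists (cf1 ++ cf2); split; first by rewrite -cat1s; apply: canonical_power_cat.
  by rewrite all_cat valid1.
exact: root_conditions_cat.
Qed.

Definition has_canonical_root cf : Prop := exists cf0, canonical_power m cf0 cf.

Lemma has_canonical_root_cat cf1 cf2 :
  has_canonical_root cf1 -> has_canonical_root cf2 -> has_canonical_root (cf1 ++ cf2).
Proof. by move=> [c1 power1] [c2 power2]; exists (c1 ++ c2); apply: canonical_power_cat. Qed.

Lemma has_canonical_root_flatten (T : eqType) (f : T -> seq (cblock R)) (s : seq T) :
  (forall t, t \in s -> has_canonical_root (f t)) -> has_canonical_root (flatten (map f s)).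
Proof.
elim: s => [|t s IH] root_f /=; first by exists [::]; apply: canonical_power_nil.
apply: has_canonical_root_cat; first by apply: root_f; rewrite mem_head.
by apply: IH => u s_u; apply: root_f; rewrite in_cons s_u orbT.
Qed.

Lemma has_canonical_root_all cf :
  (forall b, b \in cf -> has_canonical_root [:: b]) -> has_canonical_root cf.
Proof. by move=> /has_canonical_root_flatten; rewrite flatten_seq1. Qed.

Lemma has_canonical_root_perm cf1 cf2 :
  perm_eq cf1 cf2 -> has_canonical_root cf2 -> has_canonical_root cf1.
Proof.
by move=> eq12 [cf0 power]; exists cf0; apply: canonical_power_perm power; rewrite perm_sym.
Qed.

Lemma positive_root (l : R) : 0 < l -> exists2 t : R, 0 < t & t ^+ m = l.
Proof.
move=> l_gt0; pose z := m.-root (l%:C%C : C).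
have z_gt0 : 0 < z by rewrite rootC_gt0 // ltcR.
have zE : z = (complex.Re z)%:C%C.
  by move: z_gt0; case: (z) => u v; rewrite ltcE /= => /andP[/eqP -> _].
exists (complex.Re z); first by rewrite -ltcR -zE.
by apply: (@complexI R); rewrite rmorphXn /= -zE rootCK.
Qed.

Lemma real_root (l : R) : 0 < l \/ (odd m /\ l < 0) ->
  exists t : R, [/\ t != 0, 0 < t ^+ m.-1 & t ^+ m = l].
Proof.
case=> [/positive_root[t t_gt0 tm]|[m_odd l_lt0]].
  by exists t; rewrite gt_eqF // exprn_gt0.
have [|t t_gt0 tm] := @positive_root (- l); first by rewrite oppr_gt0.
have m1_even : ~~ odd m.-1 by move: m_odd m_gt0; case: (m).
exists (- t); rewrite oppr_eq0 gt_eqF //; split=> //.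
  by rewrite exprNn -signr_odd (negPf m1_even) mul1r exprn_gt0.
by rewrite exprNn -signr_odd m_odd expr1 mulN1r tm opprK.
Qed.

Lemma has_canonical_root_real k (l : R) e : (0 < k)%N -> 0 < l \/ (odd m /\ l < 0) ->
  has_canonical_root [:: inl (k, l, e)].
Proof.
move=> k_gt0 /real_root[t [t_neq0 tm1_gt0 <-]].
have [W [e' [redW e'E]]] := real_jordan_power e k_gt0 t_neq0 m_gt0.
exists [:: inl (k, t, e)]; rewrite -{2}(e'E tm1_gt0).
by apply: canonical_power_real redW; apply: addn0.
Qed.

Lemma has_canonical_root_pair k (x y : R) : (0 < k)%N -> (x +i* y)%C != 0 ->
  has_canonical_root [:: inr (k, x, y)].
Proof.
move=> k_gt0 a_neq0; pose z := m.-root ((x +i* y)%C : C).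
have zm : z ^+ m = (x +i* y)%C by rewrite rootCK.
have z_neq0 : (complex.Re z +i* complex.Im z)%C != 0.
  by case: (z) zm => u v zm; apply: contra_neq a_neq0 => z0; rewrite -zm z0 expr0n gtn_eqF.
exists [:: inr (k, complex.Re z, complex.Im z)].
have := canonical_power_pair m_gt0 k_gt0 z_neq0.
by rewrite (_ : (_ +i* _)%C = z) ?zm //; case: (z).
Qed.

Lemma has_canonical_root_opposite_pair k (l : R) : (0 < k)%N -> l != 0 ->
  has_canonical_root [:: inl (k, l, true); inl (k, l, false)].
Proof.
move=> k_gt0 l_neq0; have [|cf0 power] := @has_canonical_root_pair k l 0 k_gt0.
  by rewrite eq_complex negb_and l_neq0.
by exists cf0; apply: canonical_power_split.
Qed.

Lemma has_canonical_root_zero_group a r eps : (0 < r <= m)%N -> size eps = m ->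
  (exists eta, balanced eta (take r eps) && balanced eta (drop r eps)) ->
  has_canonical_root (zero_group R a r eps).
Proof.
move=> r_bound size_eps [eta /andP[/balanced_perm perm1 /balanced_perm perm2]].
have /andP[_ le_rm] := r_bound; exists [:: inl ((a * m + r)%N, 0, eta)].
rewrite size_takel ?size_eps // in perm1; rewrite size_drop size_eps in perm2.
apply: canonical_power_perm (canonical_power_zero R a eta r_bound).
rewrite /zero_group take_size_cat ?drop_size_cat ?size_balanced_seq // perm_sym.
by apply: perm_cat; [exact: perm_map|case: ifP => // _; apply: perm_map].
Qed.

Lemma perm_sign_parts cf : perm_eq cf (neg_part cf ++ zero_part cf ++
  [seq b <- cf | if b is inl (_, l, _) then 0 < l else true]).
Proof.
apply/permP => p; rewrite !count_cat; elim: cf => [|b cf IH] //=; rewrite IH.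
case: b => [[[k l] e]|[[k x] y]] /=; last by lia.
by case: (ltgtP l 0) => _ /=; lia.
Qed.

Lemma root_conditions_root cf : all (@cb_valid R) cf -> root_conditions cf ->
  has_canonical_root cf.
Proof.
move=> /allP valid [cond_neg_cf [gs [/allP gs_ok zero_gs]]].
apply: has_canonical_root_perm (perm_sign_parts cf) _.
apply: has_canonical_root_cat; [|apply: has_canonical_root_cat].
- have [m_odd|m_even] := boolP (odd m).
    apply: has_canonical_root_all => b; rewrite mem_filter => /andP[neg_b /valid].
    by case: b neg_b => [[[k l] e]|] //= l_lt0 k_gt0; apply: has_canonical_root_real => //; right.
  have [ts [/allP ts_ok neg_ts]] := cond_neg_cf m_even; apply: has_canonical_root_perm neg_ts _.
  apply: has_canonical_root_flatten => -[k l] /ts_ok /= /andP[k_gt0 l_lt0].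
  by apply: has_canonical_root_opposite_pair; rewrite ?lt_eqF.
- apply: has_canonical_root_perm zero_gs _; apply: has_canonical_root_flatten.
  move=> [[a r] eps] /gs_ok /and4P[r_gt0 le_rm /eqP size_eps /existsP eps_balanced].
  by apply: has_canonical_root_zero_group => //; rewrite r_gt0.
apply: has_canonical_root_all => b; rewrite mem_filter => /andP[pos_b /valid].
case: b pos_b => [[[k l] e]|[[k x] y]] /= pos_b.
  by move=> k_gt0; apply: has_canonical_root_real => //; left.
move=> /andP[k_gt0 y_gt0]; apply: has_canonical_root_pair => //.
by rewrite eq_complex negb_and /= (gt_eqF y_gt0) orbT.
Qed.

End Roots.

Section QuaternionicRoots.
Variables (R : realType) (n m : nat) (H : 'M[R[i]]_(n + n)).
Implicit Types (W : 'M[R[i]]_(n + n, n)) (cf : seq (cblock R)).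
Hypothesis OH : in_Omega H.

Lemma qframe_power A W cf cf' : qframe H A W cf -> canonical_power m cf cf' ->
  exists W', qframe H (A ^+ m) W' cf'.
Proof.
move=> [[size_cf embW] W_qW] /(canonical_powerP _ _ size_cf)[T redT].
exists (W *m T); split; first exact: reduction_comp (pair_embeddingX m embW) redT.
by rewrite gram_mull qconjM gram_mulr W_qW mul0mx mulmx0.
Qed.

Lemma canonical_root_selfadjoint k cf0 cf : cf_size cf = k -> canonical_power m cf0 cf ->
  exists2 X : 'M_k, H_selfadjoint (cf_form_mx k cf) X & X ^+ m = cf_jordan_mx k cf.
Proof.
move=> size_cf [W [eq_size embW]]; have size_cf0 : cf_size cf0 = k by rewrite -eq_size.
have /(canonical_powerP _ _ size_cf0)[T [_ [JT FT]]] : canonical_power m cf0 cf by exists W.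
have uT : T \in unitmx.
  by have := cf_form_mx_unit size_cf; rewrite -FT /gram !unitmx_mul => /andP[].
have embT := pair_embedding_conj (cf_jordan_mx k cf0) (cf_form_mx k cf0) uT.
exists (invmx T *m cf_jordan_mx k cf0 *m T).
  rewrite -FT; apply: pair_embedding_selfadjoint embT _.
  exact: cf_jordan_mx_selfadjoint.
have [JTm _] := pair_embeddingX m embT.
by apply: (can_inj (mulKmx uT)); rewrite -JTm JT.
Qed.

Lemma qframe_root B W cf X : in_Omega B -> qframe H B W cf -> qspan W \in unitmx ->
  H_selfadjoint (cf_form_mx n cf) X -> X ^+ m = cf_jordan_mx n cf ->
  exists A, [/\ in_Omega A, H_selfadjoint H A & A ^+ m = B].
Proof.
move=> OB frameW uS FX Xm; have [[size_cf _] _] := frameW; set S := qspan W in uS.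
have [BS HS] := qspan_embedding OH OB frameW; pose D := dsum_mx X (cconj_mx X).
have OS : in_Omega S by apply/in_Omega_qspanP; exists W.
have OD : in_Omega D by exists X, 0; rewrite raddf0 oppr0.
pose A := S *m D *m invmx S; have AS : A *m S = S *m D by rewrite /A mulmxKV.
exists A; split; first by apply: Omega_mul; [apply: Omega_mul|apply: Omega_inv].
  have embA : pair_embedding A H S D (gram H S S) by [].
  apply: pair_embedding_selfadjoint (pair_embedding_inv uS embA) _.
  rewrite HS; apply: dsum_selfadjoint => //.
  rewrite /H_selfadjoint -[X in X *m _](cconj_cf_form_mx size_cf) -cconj_mxM FX cconj_mxM.
  by rewrite cconj_cf_form_mx // cconj_adj_mx adj_cconj_mx.
apply: (can_inj (mulmxK uS)).
by rewrite (intertwine_expr m AS) expr_dsum_mx -cconj_mxX Xm.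
Qed.

End QuaternionicRoots.

Theorem mainTheorem5 (R : realType) (n m : nat) (B H : 'M[complex R]_(n + n)) :
  (1 <= m)%N -> in_Omega B -> in_Omega H -> H \in unitmx -> is_hermitian_mx H ->
  H_selfadjoint H B ->
  ((exists A : 'M[complex R]_(n + n), [/\ in_Omega A, H_selfadjoint H A & A ^+ m = B]) <->
   (exists (S : 'M[complex R]_(n + n)) (cf : seq (cblock R)),
      [/\ canonical_reduction B H S cf,
          (~~ odd m -> cond_neg cf) & cond_zero m cf])).
Proof.
move=> m_gt0 OB OH uH hermH HB; split.
  move=> [A [OA HA AmB]].
  have [W [cf [frameW valid]]] := qframe_exists OH hermH OA HA uH.
  have [cf' [power valid' [neg' zero']]] := canonical_power_exists m_gt0 valid.
  have [W' frameW'] := qframe_power frameW power; rewrite AmB in frameW'.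
  exists (qspan W'), cf'; split=> //.
  by apply/(canonical_reductionP OH _ _ OB); exists W'.
move=> [S [cf [redS neg zero]]]; have [_ uS _ size_cf _] := redS.
have [W [SW frameW valid]] := (canonical_reductionP OH S cf OB).1 redS.
have [cf0 power] := root_conditions_root m_gt0 valid (conj neg zero).
have [X FX Xm] := canonical_root_selfadjoint size_cf power.
by apply: qframe_root OB frameW _ FX Xm; rewrite // -SW.
Qed.
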